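(* Let $k$ be an algebraically closed field of characteristic zero and let $m,n,r,s\ge0$ be integers with $m-n\ge r+s$. Then the rational Schur superalgebra $\mathcal{S}(m|n;r,s)=(\tilde{\mathcal{A}}(m|n;r,s))^*$ is semisimple as an algebra.
   Context: Superspaces are $\mathbb{Z}/2$-graded $k$-vector spaces; structure maps of superalgebras and supercoalgebras are even linear maps; tensor products of superalgebras have multiplication $(x\otimes y)(w\otimes z)=(-1)^{|y||w|}xw\otimes yz$. For $1\le i\le m+n$ put $|i|=0$ if $i\le m$ and $|i|=1$ if $i>m$. $k[GL(m|n)]$ is the localization of the free supercommutative superalgebra $k[x_{ij}:1\le i,j\le m+n]$ (with $x_{ij}$ of parity $|i|+|j|$) at $\det(x_{ij})_{1\le i,j\le m}\cdot\det(x_{ij})_{m+1\le i,j\le m+n}$. It is a Hopf superalgebra with $\Delta(x_{ij})=\sum_l x_{il}\otimes x_{lj}$, $\epsilon(x_{ij})=\delta_{ij}$. Let $\tilde{x}_{ij}$ be the $(i,j)$ entry of the inverse of the matrix $(x_{ij})$. $\tilde{\mathcal{A}}(m|n;r,s)$ is the span in $k[GL(m|n)]$ of all products of $r$ elements $x_{ij}$ followed by $s$ elements $\tilde{x}_{ij}$; it is a finite-dimensional sub-supercoalgebra of $k[GL(m|n)]$. Its dual $\mathcal{S}(m|n;r,s)$ is a superalgebra with multiplication dual to $\Delta$: $(fg)(a)=(f\otimes g)(\Delta(a))$, with $\langle f\otimes g,a\otimes b\rangle=(-1)^{|g||a|}f(a)g(b)$, and unit $\epsilon$. ''Semisimple as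 an algebra'' refers to the underlying ungraded associative algebra. *)

(* Defs.v *)
From HB Require Import structures.
From mathcomp Require Import all_boot all_order all_algebra.
From mathcomp Require Import boolp.

Set Implicit Arguments.
Unset Strict Implicit.
Unset Printing Implicit Defensive.

Import GRing.Theory.
Local Open Scope ring_scope.

(* A superalgebra is an algebra graded by bool (false = even, true = odd);    *)
(* the grading is given by the projections onto the homogeneous components.   *)
Record superAlgebra (k : fieldType) := SuperAlgebra {
  salg :> algType k;
  part : bool -> salg -> salg;
  part_linear : forall p, linear (part p);
  part_sum : forall a, part false a + part true a = a;
  part_part : forall p q a, part p (part q a) = if p == q then part q a else 0;
  part_one : part false 1 = 1;
  part_mul : forall p q a b, part p a = a -> part q b = b ->
    part (p (+) q) (a * b) = a * b
}.

Definition homog (k : fieldType) (A : superAlgebra k) (p : bool) (a : A) : Prop :=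
  part p a = a.

(* In characteristic 2 one would also require odd elements to square to 0.    *)
Definition supercommutative (k : fieldType) (A : superAlgebra k) : Prop :=
  forall p q (a b : A), homog p a -> homog q b -> a * b = (-1) ^+ (p && q) * (b * a).

Definition even_map (k : fieldType) (A B : superAlgebra k) (h : A -> B) : Prop :=
  forall p a, h (part p a) = part p (h a).

Definition invertible (R : pzRingType) (a : R) : Prop :=
  exists b, a * b = 1 /\ b * a = 1.

Definition free_supercommutative (k : fieldType) (I : Type) (par : I -> bool)
    (P : superAlgebra k) (x : I -> P) : Prop :=
  [/\ supercommutative P,
      forall i, homog (par i) (x i) &
      forall (B : superAlgebra k) (y : I -> B), supercommutative B ->
        (forall i, homog (par i) (y i)) ->
        (exists h : {lrmorphism P -> B}, even_map h /\ forall i, h (x i) = y i) /\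
        (forall h h' : {lrmorphism P -> B}, even_map h -> even_map h' ->
           (forall i, h (x i) = y i) -> (forall i, h' (x i) = y i) -> h =1 h')].

(* iota : P -> A is the localization of P at d, among supercommutative        *)
(* superalgebras.                                                             *)
Definition super_localization (k : fieldType) (P : superAlgebra k) (d : P)
    (A : superAlgebra k) (iota : {lrmorphism P -> A}) : Prop :=
  [/\ supercommutative A, even_map iota, invertible (iota d) &
      forall (B : superAlgebra k) (g : {lrmorphism P -> B}), supercommutative B ->
        even_map g -> invertible (g d) ->
        (exists h : {lrmorphism A -> B}, even_map h /\ forall a, h (iota a) = g a) /\
        (forall h h' : {lrmorphism A -> B}, even_map h -> even_map h' ->
           (forall a, h (iota a) = g a) -> (forall a, h' (iota a) = g a) ->
           h =1 h')].

(* The index i : 'I_(m + n) is counted from 0.                                *)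
Definition ipar (m n : nat) (i : 'I_(m + n)) : bool := (m <= i)%N.

Definition is_coordinate_GL (k : fieldType) (m n : nat) (A : superAlgebra k)
    (X : 'M[A]_(m + n)) : Prop :=
  exists (P : superAlgebra k) (x : 'I_(m + n) * 'I_(m + n) -> P)
         (iota : {lrmorphism P -> A}),
    let XP := \matrix_(i, j) x (i, j) in
    [/\ free_supercommutative (fun ij => ipar ij.1 (+) ipar ij.2) x,
        super_localization (\det (ulsubmx XP) * \det (drsubmx XP)) iota &
        X = map_mx iota XP].

Definition bilinear_map (k : fieldType) (U V W : lmodType k) (b : U -> V -> W) : Prop :=
  (forall v, linear (fun u => b u v)) /\ (forall u, linear (b u)).

(* T is the tensor product of A and B, a (x) b being tens a b.                *)
Definition is_super_tensor (k : fieldType) (A B T : superAlgebra k)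
    (tens : A -> B -> T) : Prop :=
  [/\ bilinear_map tens,
      forall (V : lmodType k) (b : A -> B -> V), bilinear_map b ->
        (exists h : {linear T -> V}, forall x y, h (tens x y) = b x y) /\
        (forall h h' : {linear T -> V}, (forall x y, h (tens x y) = b x y) ->
           (forall x y, h' (tens x y) = b x y) -> h =1 h'),
      forall p q x y, homog p x -> homog q y -> homog (p (+) q) (tens x y),
      tens 1 1 = 1 &
      forall p q x y w z, homog p y -> homog q w ->
        tens x y * tens w z = (-1) ^+ (p && q) * tens (x * w) (y * z)].

(* k[GL(m|n)] with its generic matrix, the inverse of that matrix, and its    *)
(* comultiplication and counit.  The superalgebra is pinned down, up to       *)
(* unique isomorphism, by glXP, and the remaining data by their properties.   *)
Record coordinateGL (k : fieldType) (m n : nat) := CoordinateGL {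
  glA :> superAlgebra k;
  glX : 'M[glA]_(m + n);
  glXP : is_coordinate_GL glX;
  glXinv : 'M[glA]_(m + n);
  glXinvP : glX *m glXinv = 1%:M /\ glXinv *m glX = 1%:M;
  glT : superAlgebra k;
  gltens : glA -> glA -> glT;
  gltensP : is_super_tensor gltens;
  glDelta : {lrmorphism glA -> glT};
  glDelta_even : even_map glDelta;
  glDeltaX : forall i j, glDelta (glX i j) = \sum_l gltens (glX i l) (glX l j);
  gleps : {lrmorphism glA -> k^o};
  gleps_odd : forall a, homog true a -> gleps a = 0;
  glepsX : forall i j, gleps (glX i j) = (i == j)%:R
}.

Section RationalCoefficients.
Variables (k : fieldType) (m n : nat) (G : coordinateGL k m n) (r s : nat).

Let I : finType := ('I_(m + n) * 'I_(m + n))%type.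

Definition rat_monomial (u : {ffun 'I_r -> I}) (v : {ffun 'I_s -> I}) : G :=
  (\prod_(t < r) glX G (u t).1 (u t).2) * (\prod_(t < s) glXinv G (v t).1 (v t).2).

Definition rat_coeff_pred : {pred glA G} := fun a =>
  `[< exists c : {ffun 'I_r -> I} -> {ffun 'I_s -> I} -> k,
        a = \sum_u \sum_v c u v *: rat_monomial u v >].

Lemma rat_coeff_submod_closed : submod_closed rat_coeff_pred.
Proof.
split=> [|c a b /asboolP[f ->] /asboolP[g ->]]; apply/asboolP.
  exists (fun _ _ => 0); rewrite big1 // => u _.
  by rewrite big1 // => v _; rewrite scale0r.
exists (fun u v => c * f u v + g u v).
rewrite scaler_sumr -big_split; apply: eq_bigr => u _ /=.
rewrite scaler_sumr -big_split; apply: eq_bigr => v _ /=.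
by rewrite scalerDl scalerA.
Qed.

HB.instance Definition _ :=
  GRing.isSubmodClosed.Build k G rat_coeff_pred rat_coeff_submod_closed.

Record ratCoeff := RatCoeff { rcval : glA G; _ : rcval \in rat_coeff_pred }.

HB.instance Definition _ := [isSub for rcval].
HB.instance Definition _ := [Choice of ratCoeff by <:].
HB.instance Definition _ := [SubChoice_isSubLmodule of ratCoeff by <:].

(* f \in (ratCoeff)^* is homogeneous of parity p if it kills the other part.  *)
Definition homog_dual (p : bool) (f : {scalar ratCoeff}) : Prop :=
  forall b, homog (~~ p) (rcval b) -> f b = 0.

(* ev identifies the algebra S with the dual of ratCoeff, with unit the       *)
(* counit and product (f g)(a) = (f (x) g)(Delta a), where                    *)
(* <f (x) g, b (x) c> = (-1)^(|g||b|) f(b) g(c).  The product is given on     *)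
(* homogeneous g, which span, by expanding Delta a inside                     *)
(* ratCoeff (x) ratCoeff with homogeneous left factors b t.                   *)
Definition is_rational_Schur (S : algType k) (ev : S -> {scalar ratCoeff}) : Prop :=
  [/\ forall c f g a, ev (c *: f + g) a = c * ev f a + ev g a,
      forall f g, ev f =1 ev g -> f = g,
      forall phi : {scalar ratCoeff}, exists f, ev f =1 phi,
      forall a, ev 1 a = gleps G (rcval a) &
      forall f g p, homog_dual p (ev g) ->
      forall (a : ratCoeff) (N : nat) (b c : 'I_N -> ratCoeff) (q : 'I_N -> bool),
        (forall t, homog (q t) (rcval (b t))) ->
        glDelta G (rcval a) = \sum_t gltens (rcval (b t)) (rcval (c t)) ->
        ev (f * g) a = \sum_t (-1) ^+ (p && q t) * (ev f (b t) * ev g (c t))].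

End RationalCoefficients.

Definition left_ideal (R : pzRingType) (J : R -> Prop) : Prop :=
  [/\ J 0, forall a b, J a -> J b -> J (a + b) & forall c a, J a -> J (c * a)].

(* The left regular module is semisimple: every submodule has a complement.   *)
Definition semisimple (R : pzRingType) : Prop :=
  forall J : R -> Prop, left_ideal J ->
    exists J' : R -> Prop,
      [/\ left_ideal J',
          forall a, exists b c, [/\ J b, J' c & a = b + c] &
          forall a, J a -> J' a -> a = 0].

(* Main.v *)
From HB Require Import structures.
Require Import Defs.
From mathcomp Require Import all_boot all_order all_algebra zify ring boolp.

(** M = V^(x)r (x) (V^star)^(x)s is a faithful representation of S, so it is enough to
average linear projections of M: one needs a separability idempotent in
S (x) S^op.  Since S contains the image of gl(m|n) (points of GL(m|n) over the
dual numbers), the Casimir operator C of gl(m|n) acts on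
End M = V^(x)N (x) (V^star)^(x)N, N = r + s, by an element of S (x) S^op, and
the idempotent is q(C) with char_poly C = 'X^j * q, normalized by q(0) = 1.

This works because C^j w = 0 implies that w is invariant under the whole
supergroup, hence commutes with S.  Put delta = m - n.  On tensors having f
remaining pairs of slots, C = 2 H - 2 K, where H = f delta + (the super
transpositions of slots of the same kind) and K is the sum of the
contractions.  The contractions commute with C and lower f, so by induction on
j and f both C w and K w are invariant, and so is H w.  Finally H commutes
with the supergroup and is injective: there are f (f - 1) transpositions, each
a signed permutation of the basis, and f (f - 1) < f delta as f <= N <= delta,
so H is a strictly diagonally dominant integer matrix.

The parity operator of M lies in S (it is the point diag(1, -1) of GL(m|n)),
so all projections can be taken even; this removes the difference between
graded and ungraded semisimplicity. *)

Set Implicit Arguments.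
Unset Strict Implicit.
Unset Printing Implicit Defensive.
Import Order.TTheory GRing.Theory Num.Theory.
Local Open Scope ring_scope.

(** * Operators acting on one slot of a tensor *)

(** The supergroup has no averaging of its own, as its representations are not completely reducible
    in general; the implication from C^j w = 0 to invariance replaces it. It is applied to w = q(C)
    x, for which C^j w = 0 by Cayley-Hamilton. The normalization q(0) = 1 is the one needed because
    C is a sum of iterated brackets, and multiplication S (x) S^op -> S kills a bracket with 1: only
    the constant term of q(C) reaches S, so the averaged projection still fixes the submodule.

    Invariance under the whole supergroup means invariance under one point, the generic matrix over
    k[GL(m|n)]. Its entries supercommute but do not commute, so tensors have coefficients in an
    arbitrary ring acting from the left, and every Koszul sign is an explicit boolean.

    A contraction K of one pair is followed by inserting the canonical invariant, so it stays in the
    same tensor space and K^2 = delta K. The smaller tensor space of the induction is thus replaced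
    by an eigenspace of the contractions made so far. In the double induction C w lowers j at fixed
    f, whereas K w lowers f at fixed j. *)

Definition sg (V : zmodType) (b : bool) (x : V) : V := if b then - x else x.

Lemma sg_sg (V : zmodType) a b (x : V) : sg a (sg b x) = sg (a (+) b) x.
Proof. by case: a b => [] [] //=; rewrite /sg ?opprK. Qed.

Lemma sg_sum (V : zmodType) b (J : Type) (l : seq J) (P : pred J) (F : J -> V) :
  sg b (\sum_(j <- l | P j) F j) = \sum_(j <- l | P j) sg b (F j).
Proof. by case: b => //=; rewrite -sumrN. Qed.

Lemma sgD (V : zmodType) b (x y : V) : sg b (x + y) = sg b x + sg b y.
Proof. by case: b => //=; rewrite opprD. Qed.

Lemma sg0 (V : zmodType) b : sg b (0 : V) = 0.
Proof. by case: b; rewrite /sg ?oppr0. Qed.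

Lemma sgMl (R : pzRingType) b (x y : R) : sg b x * y = sg b (x * y).
Proof. by case: b; rewrite /sg ?mulNr. Qed.

Lemma sgMr (R : pzRingType) b (x y : R) : x * sg b y = sg b (x * y).
Proof. by case: b; rewrite /sg ?mulrN. Qed.

Lemma raddf_sg (U V : zmodType) (f : {additive U -> V}) b (x : U) :
  f (sg b x) = sg b (f x).
Proof. by case: b; rewrite /sg ?raddfN. Qed.

Lemma sg_ffunE (D : finType) (V : zmodType) b (w : {ffun D -> V}) d :
  (sg b w) d = sg b (w d).
Proof. by case: b; rewrite /sg ?ffunE. Qed.

Section SlotOps.
Variables (I T : finType) (par : I -> bool) (pos : T -> nat) (kap : T -> bool).
Hypothesis pos_inj : injective pos.
Notation D := {ffun T -> I}.
Implicit Types (d : D) (t s u v : T) (i j a b : I).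

Definition upd d t i : D := [ffun x => if x == t then i else d x].
Definition after t d : bool := \big[addb/false]_(x | (pos t < pos x)%N) par (d x).

Lemma upd_same d t i : upd d t i t = i.
Proof. by rewrite ffunE eqxx. Qed.

Lemma upd_other d t s i : s != t -> upd d t i s = d s.
Proof. by rewrite ffunE => /negPf ->. Qed.

Lemma upd_upd d t i j : upd (upd d t i) t j = upd d t j.
Proof. by apply/ffunP => x; rewrite !ffunE; case: eqP. Qed.

Lemma updC d t s i j : t != s -> upd (upd d t i) s j = upd (upd d s j) t i.
Proof.
move=> ts; apply/ffunP => x; rewrite !ffunE; case: (x =P s) => [->|//].
by rewrite eq_sym (negPf ts).
Qed.

Lemma upd_id d t : upd d t (d t) = d.
Proof. by apply/ffunP => x; rewrite !ffunE; case: eqP => [->|]. Qed.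

Lemma after_upd d t s i :
  after t (upd d s i) = after t d (+) ((pos t < pos s)%N && (par (d s) (+) par i)).
Proof.
rewrite /after; case: (boolP (pos t < pos s)%N) => ts /=.
  rewrite (bigD1 s) //= upd_same [in RHS](bigD1 s) //=.
  rewrite (eq_bigr (fun x => par (d x))) => [|x /andP[_ xs]]; last by rewrite upd_other.
  by case: (par i) (par (d s)) => [] [] //=; rewrite ?addbF ?addbT ?negbK.
rewrite addbF; apply: eq_bigr => x tx; rewrite upd_other //.
by apply: contraNN ts => /eqP <-.
Qed.

Lemma pos_gtE t s : t != s -> (pos s < pos t)%N = ~~ (pos t < pos s)%N.
Proof.
by move=> ts; rewrite -leqNgt [RHS]leq_eqVlt (inj_eq pos_inj) eq_sym (negPf ts).
Qed.

Section Ring.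
Variable B : pzRingType.
Notation W := {ffun D -> B}.
Implicit Types (w : W) (c : I -> I -> B).

(* [after t d] is the sign picked up by an odd operator on its way from the right
   end to slot [t]; a dual slot contributes its own parity as well, because there
   [slotop t c] acts by a supertranspose. *)
Definition slot_sign t d i :=
  (par (d t) (+) par i) && ((kap t && par (d t)) (+) after t d).

Definition slotop t c w : W :=
  [ffun d => \sum_i sg (slot_sign t d i) (c (d t) i * w (upd d t i))].

Lemma slotopE t c w d :
  slotop t c w d = \sum_i sg (slot_sign t d i) (c (d t) i * w (upd d t i)).
Proof. exact: ffunE. Qed.

Lemma slotop_is_additive t c : zmod_morphism (slotop t c).
Proof.
move=> w w'; apply/ffunP => d; rewrite !ffunE -sumrB; apply: eq_bigr => i _.
by rewrite !ffunE mulrBr; case: (slot_sign _ _ _) => //=; rewrite opprB opprK addrC.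
Qed.

HB.instance Definition _ t c :=
  GRing.isZmodMorphism.Build W W (slotop t c) (slotop_is_additive t c).

Lemma slotop2 t s c c' w d : t != s ->
  slotop t c (slotop s c' w) d = \sum_i \sum_j
   sg (slot_sign t d i (+) (slot_sign s d j
        (+) ((par (d s) (+) par j) && ((pos s < pos t)%N && (par (d t) (+) par i)))))
     (c (d t) i * c' (d s) j * w (upd (upd d t i) s j)).
Proof.
move=> ts; rewrite ffunE; apply: eq_bigr => i _; rewrite ffunE mulr_sumr sg_sum.
apply: eq_bigr => j _; rewrite sgMr sg_sg mulrA /slot_sign after_upd.
rewrite (@upd_other _ t s) 1?eq_sym //; congr (sg _ _).
by case: (par (d s) (+) par j) => /=; rewrite ?addbF // !addbA.
Qed.

(** [e] is the sign left over after the coefficients have paid their share. It is [false] for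
    points, whose odd entries supercommute, and the product of the two parities for elementary
    matrices, whose coefficients are plain scalars. *)
Lemma slotopC t s c c' w e : t != s ->
  (forall a b a' b', c a b * c' a' b' =
     sg (e (+) ((par a (+) par b) && (par a' (+) par b'))) (c' a' b' * c a b)) ->
  slotop t c (slotop s c' w) = sg e (slotop s c' (slotop t c w)).
Proof.
move=> ts cc'; have st : s != t by rewrite eq_sym.
apply/ffunP => d; rewrite sg_ffunE !slotop2 //.
rewrite exchange_big sg_sum; apply: eq_bigr => j _; rewrite sg_sum.
apply: eq_bigr => i _; rewrite (updC _ _ _ ts) cc' sgMl !sg_sg pos_gtE //.
congr (sg _ _); move: (slot_sign _ _ _) (slot_sign _ _ _) => x y.
by case: (par (d t) (+) par i); case: (par (d s) (+) par j); case: (_ < _)%N;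
  case: x; case: y; case: e cc'.
Qed.

(** Changing slot [t] does not affect [after t], so ordinary slots compose without sign; the term
    [par (d t)] of a dual slot leaves the Koszul sign of the supertranspose of a product. *)
Lemma slotop_comp t c c' w :
  slotop t c (slotop t c' w) = slotop t (fun a b =>
    \sum_i sg (kap t && ((par a (+) par i) && (par i (+) par b))) (c a i * c' i b)) w.
Proof.
apply/ffunP => d; rewrite !ffunE.
under eq_bigr => i _ do rewrite ffunE mulr_sumr sg_sum upd_same.
rewrite exchange_big; apply: eq_bigr => j _ /=; rewrite mulr_suml sg_sum.
apply: eq_bigr => i _; rewrite upd_upd sgMr sgMl !sg_sg mulrA; congr (sg _ _).
rewrite /slot_sign after_upd upd_same ltnn /= addbF.
by case: (par (d t)); case: (par i); case: (par j); case: (kap t); case: (after _ _).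
Qed.

Lemma slotop1 t w : slotop t (fun a b => (a == b)%:R) w = w.
Proof.
apply/ffunP => d; rewrite ffunE (bigD1 (d t)) //= eqxx mul1r upd_id /slot_sign addbb.
by rewrite big1 ?addr0 // => i /negPf it; rewrite eq_sym it mul0r sg0.
Qed.

Lemma eq_slotop t c c' w : (forall a b, c a b = c' a b) -> slotop t c w = slotop t c' w.
Proof. by move=> cc'; apply/ffunP => d; rewrite !ffunE; apply: eq_bigr => i _; rewrite cc'. Qed.

End Ring.
End SlotOps.

(** * The action of gl(m|n) and its Casimir operator *)

Section Units.
Variables (I T : finType) (par : I -> bool) (pos : T -> nat) (kap : T -> bool).
Hypothesis pos_inj : injective pos.
Variable B : pzRingType.
Notation D := {ffun T -> I}.
Notation W := {ffun D -> B}.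
Implicit Types (d : D) (t s u v : T) (i j a b : I) (w : W).

Notation slotop := (slotop par pos kap).
Notation p i j := (par i (+) par j).

(* The elementary matrix of gl(m|n) acts on V by the elementary matrix and on the
   dual by minus its supertranspose. *)
Definition unit_coef (kp : bool) i j a b : B :=
  if kp then - ((a == j) && (b == i))%:R else ((a == i) && (b == j))%:R.

Definition gl_unit t i j : W -> W := slotop t (unit_coef (kap t) i j).

HB.instance Definition _ t i j := GRing.Additive.copy (gl_unit t i j) (slotop t (unit_coef (kap t) i j)).

Lemma gl_unitC u v i j k l w : u != v ->
  gl_unit u i j (gl_unit v k l w) = sg (p i j && p k l) (gl_unit v k l (gl_unit u i j w)).
Proof.
move=> uv; apply: slotopC => // a b a' b'; rewrite /unit_coef.
case: (kap u); case: (kap v); rewrite ?mulrNN ?mulNr ?mulrN;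
  case: (a =P _) => [->|_]; case: (b =P _) => [->|_] /=;
  rewrite ?mul0r ?mulr0 ?oppr0 ?sg0 //;
  case: (a' =P _) => [->|_]; case: (b' =P _) => [->|_] /=;
  rewrite ?mul0r ?mulr0 ?oppr0 ?sg0 //;
  by case: (par i); case: (par j); case: (par k); case: (par l).
Qed.

Lemma gl_unit_comp0 t i j k l w : ~~ kap t -> gl_unit t i j (gl_unit t k l w) = if j == k then gl_unit t i l w else 0.
Proof.
move=> /negPf kt; rewrite /gl_unit slotop_comp kt /=; case: (j =P k) => [->|jk].
  apply: eq_slotop => a b; rewrite (bigD1 k) //= eqxx andbT big1 ?addr0 => [|x /negPf xk].
    by rewrite -natrM mulnb.
  by rewrite xk andbF mul0r.
apply/ffunP => d; rewrite !ffunE big1 // => b _.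
rewrite big1 ?mul0r ?sg0 // => x _; rewrite -natrM mulnb.
by case: (x =P j) => [->|]; rewrite ?andbF // (introF eqP jk) !andbF.
Qed.

(** The supertranspose reverses products, and the two minus signs of the dual action leave one to be
    restored; hence the reversed indices and the negation in the sign. *)
Lemma gl_unit_comp1 t i j k l w : kap t ->
  gl_unit t i j (gl_unit t k l w) = if i == l then sg (~~ (p i j && p k l)) (gl_unit t k j w) else 0.
Proof.
move=> kt; rewrite /gl_unit slotop_comp kt /=; case: (i =P l) => [<-|il].
  rewrite -raddf_sg /=; apply/ffunP => d; rewrite !ffunE; apply: eq_bigr => b _.
  rewrite (bigD1 i) //= eqxx andbT big1 ?addr0 => [|x /negPf xk]; last first.
    by rewrite xk andbF oppr0 mul0r sg0.
  rewrite sg_ffunE mulrNN -natrM mulnb /= sgMr mulNr !sgMl.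
  case: (d t =P j) => [->|] /=; last by rewrite mul0r ?oppr0 !sg0.
  case: (b =P k) => [->|] /=; last by rewrite mul0r ?oppr0 !sg0.
  by congr (sg _ _); case: (par i); case: (par j); case: (par k); rewrite /sg /= ?opprK.
apply/ffunP => d; rewrite !ffunE big1 // => b _.
rewrite big1 ?mul0r ?sg0 // => x _; rewrite mulrNN -natrM mulnb.
by case: (x =P i) => [->|]; rewrite ?andbF ?sg0 // (introF eqP il) !andbF sg0.
Qed.

Lemma gl_unit_sum t w : \sum_i gl_unit t i i w = sg (kap t) w.
Proof.
rewrite -[in RHS](slotop1 par pos kap t w) -raddf_sg /=.
apply/ffunP => d; rewrite sum_ffunE ffunE.
under eq_bigr => i _ do rewrite ffunE.
rewrite exchange_big; apply: eq_bigr => j _ /=; rewrite -sg_sum -mulr_suml; congr (sg _ _).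
rewrite sg_ffunE sgMr -sgMl; congr (_ * _).
rewrite (bigD1 j) //= big1 => [|x /negPf xj]; rewrite /unit_coef.
  by rewrite addr0 eqxx andbT /sg; case: (kap t).
by rewrite ![j == _]eq_sym xj andbF oppr0; case: (kap t).
Qed.

Definition gl_sum i j w : W := \sum_t gl_unit t i j w.
(** The split Casimir element, with its two legs acting on the slots [u] and [v]; [casimir] is its
    sum over all ordered pairs of slots, including [u = v]. *)
Definition omega u v w : W := \sum_i \sum_j sg (par j) (gl_unit u i j (gl_unit v j i w)).
Definition casimir w : W := \sum_i \sum_j sg (par j) (gl_sum i j (gl_sum j i w)).

Lemma gl_sum_is_additive i j : zmod_morphism (gl_sum i j).
Proof. by move=> w w'; rewrite -sumrB; apply: eq_bigr => t _; rewrite raddfB. Qed.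
HB.instance Definition _ i j := GRing.isZmodMorphism.Build W W (gl_sum i j) (gl_sum_is_additive i j).

Lemma omega_is_additive u v : zmod_morphism (omega u v).
Proof.
move=> w w'; rewrite -sumrB; apply: eq_bigr => i _; rewrite -sumrB; apply: eq_bigr => j _.
by rewrite !raddfB; case: (par j) => //=; rewrite opprB opprK addrC.
Qed.
HB.instance Definition _ u v := GRing.isZmodMorphism.Build W W (omega u v) (omega_is_additive u v).

Lemma casimir_is_additive : zmod_morphism casimir.
Proof.
move=> w w'; rewrite -sumrB; apply: eq_bigr => i _; rewrite -sumrB; apply: eq_bigr => j _.
by rewrite !raddfB; case: (par j) => //=; rewrite opprB opprK addrC.
Qed.
HB.instance Definition _ := GRing.isZmodMorphism.Build W W casimir casimir_is_additive.

Lemma omegaC u v w : u != v -> omega u v w = omega v u w.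
Proof.
move=> uv; rewrite /omega exchange_big; apply: eq_bigr => j _; apply: eq_bigr => i _.
by rewrite gl_unitC // sg_sg; congr (sg _ _); case: (par i); case: (par j).
Qed.

Lemma gl_unit_omega x u v k l w : x != u -> x != v -> gl_unit x k l (omega u v w) = omega u v (gl_unit x k l w).
Proof.
move=> xu xv; rewrite raddf_sum; apply: eq_bigr => i _; rewrite raddf_sum; apply: eq_bigr => j _.
rewrite raddf_sg /= gl_unitC //= [gl_unit x k l (gl_unit v _ _ _)]gl_unitC // raddf_sg !sg_sg; congr (sg _ _).
by case: (par i); case: (par j); case: (par k); case: (par l).
Qed.

Lemma omega_omega u v u' v' w : u != u' -> u != v' -> v != u' -> v != v' ->
  omega u v (omega u' v' w) = omega u' v' (omega u v w).
Proof.
move=> uu uv vu vv.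
have omegaE z : omega u v z = \sum_i \sum_j sg (par j) (gl_unit u i j (gl_unit v j i z)) by [].
rewrite (omegaE w) (omegaE (omega _ _ _)) raddf_sum; apply: eq_bigr => i _; rewrite raddf_sum; apply: eq_bigr => j _.
by rewrite raddf_sg /= -!gl_unit_omega.
Qed.

Variable delta : nat.
Hypothesis sdim : forall w, \sum_i sg (par i) w = w *+ delta.

(** The Casimir element acts on the natural module, and equally on its dual, by the superdimension:
    the inner sum over one index of the signs is [delta], and the diagonal units that remain add up
    to 1 or -1. *)
Lemma omega_diag u w : omega u u w = w *+ delta.
Proof.
rewrite /omega; case: (boolP (kap u)) => ku.
  under eq_bigr => i _ do under eq_bigr => j _ do rewrite gl_unit_comp1 // eqxx sg_sg.
  rewrite exchange_big /=.
  transitivity (- \sum_j \sum_i sg (par i) (gl_unit u j j w)).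
    rewrite -sumrN; apply: eq_bigr => j _; rewrite -sumrN; apply: eq_bigr => i _.
    by case: (par i); case: (par j); rewrite /sg /= ?opprK.
  under eq_bigr => j _ do rewrite sdim.
  by rewrite sumrMnl gl_unit_sum ku /sg mulNrn opprK.
under eq_bigr => i _ do under eq_bigr => j _ do rewrite gl_unit_comp0 // eqxx.
under eq_bigr => i _ do rewrite sdim.
by rewrite sumrMnl gl_unit_sum (negPf ku).
Qed.

(** On an ordinary and a dual slot [omega] is minus a contraction followed by the insertion of the
    canonical invariant of V (x) V^star, and gl(m|n) annihilates that invariant. *)
Lemma gl_unit_omega_pair t s k l w : t != s -> ~~ kap t -> kap s ->
  gl_unit t k l (omega t s w) + gl_unit s k l (omega t s w) = 0.
Proof.
move=> ts kt ks; rewrite !raddf_sum -big_split /=.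
have st : s != t by rewrite eq_sym.
under eq_bigr => i _ do rewrite !raddf_sum -big_split /=.
transitivity (\sum_i \sum_j
  ((if l == i then sg (par j) (gl_unit t k j (gl_unit s j l w)) else 0) -
   (if k == i then sg (par j) (gl_unit t k j (gl_unit s j l w)) else 0))).
  apply: eq_bigr => i _; apply: eq_bigr => j _.
  rewrite !raddf_sg /= gl_unit_comp0 // [gl_unit s k l _]gl_unitC // gl_unit_comp1 //; congr (_ + _).
    by case: eqP => [->|_]; rewrite ?sg0.
  case: eqP => [->|_]; last by rewrite raddf0 !sg0 oppr0.
  rewrite raddf_sg /= !sg_sg -[- _]/(sg true _) sg_sg; congr (sg _ _).
  by case: (par i); case: (par j); case: (par l).
under eq_bigr => i _ do rewrite sumrB.
rewrite sumrB (bigD1 l) //= eqxx [in X in _ + X - _]big1 ?addr0; last first.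
  by move=> i /negPf il; rewrite big1 // => j _; rewrite eq_sym il.
rewrite [X in _ - X](bigD1 k) //= eqxx [in X in _ - (_ + X)]big1 ?addr0 ?subrr //.
by move=> i /negPf il; rewrite big1 // => j _; rewrite eq_sym il.
Qed.

(** The counterpart on the other side: the contraction is an invariant form, so it vanishes on the
    image of the action on its two slots. *)
Lemma omega_gl_unit_pair t s k l w : t != s -> ~~ kap t -> kap s ->
  omega t s (gl_unit t k l w) + omega t s (gl_unit s k l w) = 0.
Proof.
move=> ts kt ks; rewrite -big_split /=; under eq_bigr => i _ do rewrite -big_split /=.
have st : s != t by rewrite eq_sym.
transitivity (\sum_i \sum_j
  ((if j == k then sg (par k (+) (p k i && p k l)) (gl_unit t i l (gl_unit s k i w)) else 0) -
   (if j == l then sg (par l (+) (p l i && p k l)) (gl_unit t i l (gl_unit s k i w)) else 0))).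
  apply: eq_bigr => i _; apply: eq_bigr => j _.
  congr (_ + _).
    rewrite [gl_unit s j i _]gl_unitC // raddf_sg /= gl_unit_comp0 // sg_sg.
    by case: eqP => [->|_]; rewrite ?sg0.
  rewrite gl_unit_comp1 //; case: eqP => [->|_]; last by rewrite raddf0 sg0 oppr0.
  rewrite raddf_sg /= sg_sg -[- _]/(sg true _) sg_sg; congr (sg _ _).
  by case: (par i); case: (par k); case: (par l).
rewrite big1 // => i _; rewrite sumrB -!big_mkcond !big_pred1_eq.
apply/eqP; rewrite subr_eq0; apply/eqP; congr (sg _ _).
by case: (par i); case: (par k); case: (par l).
Qed.

Lemma omega_sqr_pair t s w : t != s -> ~~ kap t -> kap s ->
  omega t s (omega t s w) = - (omega t s w *+ delta).
Proof.
move=> ts kt ks; rewrite -(omega_diag t) {1}/omega -sumrN; apply: eq_bigr => i _.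
rewrite -sumrN; apply: eq_bigr => j _.
(* Invariance moves the leg at [s] to [t] at the cost of a sign, which turns the outer [omega] into
   the Casimir element of the single slot [t]. *)
have /eqP := gl_unit_omega_pair j i w ts kt ks; rewrite addrC addr_eq0 => /eqP ->.
by rewrite raddfN; case: (par j).
Qed.

Lemma gl_sum_omega_pair t s k l w : t != s -> ~~ kap t -> kap s ->
  gl_sum k l (omega t s w) = omega t s (gl_sum k l w).
Proof.
move=> ts kt ks; rewrite /gl_sum raddf_sum.
have st : s != t by rewrite eq_sym.
rewrite (bigD1 t) //= (bigD1 s) //= addrA gl_unit_omega_pair // add0r.
rewrite [RHS](bigD1 t) //= [X in _ + X](bigD1 s) //= addrA omega_gl_unit_pair // add0r.
by apply: eq_bigr => x /andP[xt xs]; apply: gl_unit_omega.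
Qed.

Lemma casimir_omega_pair t s w : t != s -> ~~ kap t -> kap s ->
  casimir (omega t s w) = omega t s (casimir w).
Proof.
move=> ts kt ks; rewrite [in RHS]raddf_sum; apply: eq_bigr => i _.
rewrite raddf_sum; apply: eq_bigr => j _.
by rewrite raddf_sg /= -!gl_sum_omega_pair.
Qed.

Lemma gl_unit_kap0 t i j w d : ~~ kap t ->
  gl_unit t i j w d = if d t == i then sg (slot_sign par pos kap t d j) (w (upd d t j)) else 0.
Proof.
move=> /negPf kt; rewrite ffunE (bigD1 j) //= big1 ?addr0; last first.
  by move=> b /negPf bj; rewrite /unit_coef kt bj andbF mul0r sg0.
by rewrite /unit_coef kt eqxx andbT; case: eqP; rewrite ?mul1r ?mul0r ?sg0.
Qed.

Lemma gl_unit_kap1 t i j w d : kap t ->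
  gl_unit t i j w d = if d t == j then sg (~~ slot_sign par pos kap t d i) (w (upd d t i)) else 0.
Proof.
move=> kt; rewrite ffunE (bigD1 i) //= big1 ?addr0; last first.
  by move=> b /negPf bj; rewrite /unit_coef kt bj andbF oppr0 mul0r sg0.
rewrite /unit_coef kt eqxx andbT; case: eqP; rewrite ?oppr0 ?mul0r ?sg0 // mulN1r.
by rewrite -[- _]/(sg true _) sg_sg addbT.
Qed.

Definition swap d u v := upd (upd d u (d v)) v (d u).

(** The sum of the two [after] terms also counts the later of the two slots; adding it once more
    leaves the parity of the slots strictly between. [swap_sign] is then the Koszul sign of
    exchanging the two vectors. *)
Definition between d u v :=
  after par pos u d (+) after par pos v d (+) (if (pos u < pos v)%N then par (d v) else par (d u)).

Definition swap_sign d u v :=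
  (par (d u) && par (d v)) (+) ((par (d u) (+) par (d v)) && between d u v).

(** The signed sum of e_ij (x) e_ji is the super flip. On two dual slots both minus signs cancel,
    and the transposed indices merely exchange the roles of [i] and [j]. *)
Lemma omega_same u v w d : u != v -> kap u = kap v ->
  omega u v w d = sg (swap_sign d u v) (w (swap d u v)).
Proof.
move=> uv kuv; rewrite sum_ffunE; have vu : v != u by rewrite eq_sym.
under eq_bigr => i _ do rewrite sum_ffunE.
transitivity (\sum_i \sum_j if d u == i then if d v == j then
  sg (swap_sign d u v) (w (swap d u v)) else 0 else 0).
  case: (boolP (kap u)) => ku; have kv := ku; rewrite kuv in kv.
    rewrite exchange_big; apply: eq_bigr => j _; apply: eq_bigr => i _.
    rewrite sg_ffunE gl_unit_kap1 //; case: (d u =P j) => [<-|_]; last by rewrite sg0.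
    rewrite gl_unit_kap1 // upd_other //; case: (d v =P i) => [<-|_]; last by rewrite !sg0.
    rewrite !sg_sg /slot_sign after_upd upd_other // (pos_gtE pos_inj uv) ku kv.
    congr (sg _ _); rewrite /swap_sign /between.
    case: (_ < _)%N; case: (par _); case: (par _); case: (after _ _ _ _);
      by case: (after _ _ _ _).
  apply: eq_bigr => i _; apply: eq_bigr => j _.
  rewrite sg_ffunE gl_unit_kap0 //; case: (d u =P i) => [<-|_]; last by rewrite sg0.
  rewrite gl_unit_kap0 // upd_other //; case: (d v =P j) => [<-|_]; last by rewrite !sg0.
  rewrite !sg_sg /slot_sign after_upd upd_other // (pos_gtE pos_inj uv) (negPf ku) (negPf kv).
  congr (sg _ _); rewrite /swap_sign /between.
  case: (_ < _)%N; case: (par _); case: (par _); case: (after _ _ _ _);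
    by case: (after _ _ _ _).
rewrite (bigD1 (d u)) //= eqxx (bigD1 (d v)) //= eqxx !big1 ?addr0 //.
  by move=> i /negPf iu; rewrite big1 // => j _; rewrite eq_sym iu.
by move=> i /negPf iu; rewrite eq_sym iu.
Qed.

Lemma omega_opp t s w d : t != s -> ~~ kap t -> kap s ->
  omega t s w d = if d t == d s then - \sum_j
     sg (par (d t) (+) (par (d t) (+) par j) && between d t s (+) (pos t < pos s)%N && (par (d t) (+) par j)) (w (upd (upd d t j) s j)) else 0.
Proof.
move=> ts kt ks; rewrite sum_ffunE; have st : s != t by rewrite eq_sym.
under eq_bigr => i _ do rewrite sum_ffunE.
transitivity (\sum_i if d t == i then if d s == i then - \sum_j
     sg (par (d t) (+) (par (d t) (+) par j) && between d t s (+) (pos t < pos s)%N && (par (d t) (+) par j)) (w (upd (upd d t j) s j)) else 0 else 0).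
  apply: eq_bigr => i _; case: (d t =P i) => [dt|dt]; last first.
    by rewrite big1 // => j _; rewrite sg_ffunE gl_unit_kap0 // (introF eqP dt) sg0.
  case: (d s =P i) => [ds|ds]; last first.
    rewrite big1 // => j _; rewrite sg_ffunE gl_unit_kap0 // dt eqxx gl_unit_kap1 // upd_other //.
    by rewrite (introF eqP ds) !sg0.
  rewrite -sumrN; apply: eq_bigr => j _.
  rewrite sg_ffunE gl_unit_kap0 // dt eqxx gl_unit_kap1 // upd_other // ds eqxx.
  rewrite !sg_sg -[- _]/(sg true _) sg_sg /slot_sign after_upd upd_other //.
  rewrite (pos_gtE pos_inj ts) (negPf kt) ks /between ds dt; congr (sg _ _).
  case: (_ < _)%N; case: (par _); case: (par _); case: (after _ _ _ _);
    by case: (after _ _ _ _).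
rewrite (bigD1 (d t)) //= eqxx [X in _ + X]big1 ?addr0 1?[d s == _]eq_sym //.
by move=> i /negPf it; rewrite eq_sym it.
Qed.


End Units.

(** * The action of the supergroup *)

Ltac bool_atoms pr := repeat (match goal with
  | |- context [after ?q ?r ?t ?d] => case: (after q r t d)
  | |- context [(?x < ?y)%N] => case: (x < y)%N
  | |- context [pr ?z] => case: (pr z)
  end); repeat case.

Section GroupOps.
Variables (I T : finType) (par : I -> bool) (pos : T -> nat) (kap : T -> bool).
Hypothesis pos_inj : injective pos.
Notation D := {ffun T -> I}.
Implicit Types (d : D) (t s u v : T) (i j a b : I).

Notation slotop := (slotop par pos kap).
Notation slot_sign := (slot_sign par pos kap).
Notation p i j := (par i (+) par j).
Notation omega := (omega par pos kap).

(** [B] is only a ring, without grading: the parity of an entry is read off its position. *)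
Definition supercomm (B : pzRingType) (c c' : I -> I -> B) :=
  forall a b a' b', c a b * c' a' b' = sg (p a b && p a' b') (c' a' b' * c a b).

(** A dual slot carries the contragredient action, by the transpose of the inverse [g']; the signs
    of the supertranspose are already part of [slot_sign]. *)
Definition slot_coef (B : pzRingType) (g g' : I -> I -> B) (kp : bool) a b : B :=
  if kp then g' b a else g a b.

Definition grp (B : pzRingType) (g g' : I -> I -> B) t : {ffun D -> B} -> {ffun D -> B} :=
  slotop t (slot_coef g g' (kap t)).

HB.instance Definition _ (B : pzRingType) (g g' : I -> I -> B) t :=
  GRing.Additive.copy (grp g g' t) (slotop t (slot_coef g g' (kap t))).

Definition grps (B : pzRingType) (g g' : I -> I -> B) (l : seq T)
  (w : {ffun D -> B}) := foldr (grp g g') w l.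

Section Ring.
Variable B : pzRingType.
Implicit Types (w : {ffun D -> B}).

Lemma grps_is_additive (g g' : I -> I -> B) l : zmod_morphism (grps g g' l).
Proof. by move=> w w'; elim: l => //= t l ->; rewrite raddfB. Qed.
HB.instance Definition _ g g' l := GRing.isZmodMorphism.Build _ _ (grps g g' l) (@grps_is_additive g g' l).

Lemma slot_coef_supercomm (g g' h h' : I -> I -> B) k k' :
  supercomm g h -> supercomm g h' -> supercomm g' h -> supercomm g' h' ->
  supercomm (slot_coef g g' k) (slot_coef h h' k').
Proof.
move=> gh gh' g'h g'h' a b a' b'; rewrite /slot_coef.
by case: k; case: k'; rewrite ?gh ?gh' ?g'h ?g'h' //; congr (sg _ _);
  case: (par a); case: (par a'); case: (par b); case: (par b').
Qed.

Lemma grpC (g g' h h' : I -> I -> B) t s w : t != s ->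
  supercomm g h -> supercomm g h' -> supercomm g' h -> supercomm g' h' ->
  grp g g' t (grp h h' s w) = grp h h' s (grp g g' t w).
Proof.
move=> ts gh gh' g'h g'h'; rewrite -[RHS]/(sg false _).
by apply: slotopC => // a b a' b'; apply: slot_coef_supercomm.
Qed.

Definition mulc (g h : I -> I -> B) a b := \sum_i g a i * h i b.

(** On a dual slot the factors come out in the opposite order, as for inverses of products;
    reordering the entries by supercommutativity cancels the sign of [slotop_comp]. *)
Lemma grp_comp (g g' h h' : I -> I -> B) t w : supercomm g' h' ->
  grp g g' t (grp h h' t w) = grp (mulc g h) (mulc h' g') t w.
Proof.
move=> g'h'; rewrite /grp slotop_comp; apply: eq_slotop => a b.
rewrite /slot_coef /mulc; case: (kap t) => //=.
apply: eq_bigr => i _; rewrite g'h' sg_sg.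
by case: (par a); case: (par i); case: (par b).
Qed.

Variables (g g' : I -> I -> B).
Hypotheses (gg : supercomm g g) (gg' : supercomm g g').
Hypotheses (g'g : supercomm g' g) (g'g' : supercomm g' g').
Hypothesis mulgV : forall a b, mulc g g' a b = (a == b)%:R.
Hypothesis mulVg : forall a b, mulc g' g a b = (a == b)%:R.

Lemma grpK t w : grp g' g t (grp g g' t w) = w.
Proof.
rewrite grp_comp // -[RHS](slotop1 par pos kap t); apply: eq_slotop => a b.
by rewrite /slot_coef; case: (kap t); rewrite ?mulVg // eq_sym.
Qed.

Lemma grpsK l w : grps g' g l (grps g g' (rev l) w) = w.
Proof.
elim: l w => //= t l IH w; rewrite rev_cons -cats1 /grps foldr_cat.
by rewrite -/(grps g' g _ _) -/(grps g g' _ _) IH grpK.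
Qed.

Lemma grp_same x u v w : u != v -> kap u = kap v -> x != u -> x != v ->
  grp g g' x (omega u v w) = omega u v (grp g g' x w).
Proof.
move=> uv kuv xu xv; apply/ffunP => d.
have vu : v != u by rewrite eq_sym.
have ux : u != x by rewrite eq_sym.
have vx : v != x by rewrite eq_sym.
rewrite (omega_same par pos_inj) // !ffunE sg_sum; apply: eq_bigr => a _.
rewrite (omega_same par pos_inj) // /swap !upd_other // sgMr !sg_sg; congr (sg _ (_ * w _)).
  rewrite /swap_sign /between /slot_sign !after_upd !upd_other //.
  rewrite (pos_gtE pos_inj xu) (pos_gtE pos_inj xv).
  by move: (kap x); bool_atoms par.
  by rewrite (negPf xu) (negPf xv).
by rewrite (updC d _ _ xu) (updC _ _ _ xv).
Qed.

(** The flip exchanges the entries contributed by the two slots. Putting them back in order by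
    supercommutativity gives exactly the change of [swap_sign] between the old and the new
    indices. *)
Lemma grp_same2 u v w : u != v -> kap u = kap v ->
  grp g g' u (grp g g' v (omega u v w)) = omega u v (grp g g' u (grp g g' v w)).
Proof.
move=> uv kuv; have vu : v != u by rewrite eq_sym.
apply/ffunP => d; rewrite (omega_same par pos_inj) // /grp !slotop2 // exchange_big sg_sum.
apply: eq_bigr => b _; rewrite sg_sum; apply: eq_bigr => a _.
have updu x z : upd (upd d u x) v z u = x by rewrite upd_other // upd_same.
rewrite (omega_same par pos_inj) // sgMr !sg_sg /swap !updu !upd_same.
rewrite kuv [in RHS](slot_coef_supercomm _ _ gg gg' g'g g'g') [in RHS]sgMl sg_sg.
have updE x x1 z z1 : upd (upd (upd (upd d u x) v x1) u z) v z1 = upd (upd d u z) v z1.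
  by rewrite (updC _ _ _ vu) !upd_upd.
rewrite !updE; congr (sg _ _).
rewrite /swap_sign /between /slot_sign !updu !upd_same !after_upd !upd_other // ?updu ?upd_same.
rewrite (pos_gtE pos_inj uv) kuv !ltnn.
by move: (kap v); bool_atoms par.
Qed.

(** The canonical invariant is fixed by g on V together with the contragredient of g on the dual,
    because summing over its common index produces an entry of the product of [g] and [g']. *)
Lemma grp_opp t s w : t != s -> ~~ kap t -> kap s ->
  grp g g' t (grp g g' s (omega t s w)) = omega t s w.
Proof.
move=> ts kt ks; have st : s != t by rewrite eq_sym.
have updu d x z : upd (upd d t x) s z t = x by rewrite upd_other // upd_same.
have updE d x x1 z z1 : upd (upd (upd (upd d t x) s x1) t z) s z1 = upd (upd d t z) s z1.
  by rewrite (updC _ _ _ st) !upd_upd.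
apply/ffunP => d; rewrite (omega_opp par pos_inj) // /grp slotop2 // ks (negPf kt) /slot_coef.
(* The total sign of a term does not involve the summed index [a]; this is what allows the sum over
   [a] to be collected into an entry of [mulc g g']. *)
pose sgn j := ((par (d t) (+) par (d s)) && after par pos t d) (+) ~~ (par (d s) (+)
  (par (d s) (+) par j) && (after par pos t d (+) after par pos s d (+) par (d s)
    (+) ~~ (pos t < pos s)%N && (par (d t) (+) par (d s)))
  (+) (pos t < pos s)%N && (par (d s) (+) par j)).
transitivity (\sum_j sg (sgn j) (\sum_a (g (d t) a * g' a (d s)) * w (upd (upd d t j) s j))).
  under [RHS]eq_bigr => j _ do rewrite sg_sum.
  rewrite [RHS]exchange_big; apply: eq_bigr => a _.
  rewrite (bigD1 a) //= [X in _ + X]big1 ?addr0 => [|b /negPf ba]; last first.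
    by rewrite (omega_opp par pos_inj) // updu upd_same eq_sym ba mulr0 sg0.
  rewrite (omega_opp par pos_inj) // updu upd_same eqxx -[- _]/(sg true _) sgMr sg_sg mulr_sumr sg_sum.
  apply: eq_bigr => j _; rewrite sgMr sg_sg updE; congr (sg _ _).
  rewrite /sgn /slot_sign /between !after_upd !updu !upd_same !upd_other // !ltnn.
  rewrite (pos_gtE pos_inj ts) ks (negPf kt).
  by bool_atoms par.
have mV := mulgV (d t) (d s); rewrite /mulc in mV.
under eq_bigr => j _ do rewrite -mulr_suml mV.
case: (d t =P d s) => [dts|_]; last by rewrite big1 // => j _; rewrite mul0r sg0.
rewrite -sumrN; apply: eq_bigr => j _; rewrite mul1r -[- _]/(sg true _) sg_sg; congr (sg _ _).
rewrite /sgn /between dts; by bool_atoms par.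
Qed.

End Ring.

End GroupOps.

(** * Diagonal dominance *)

Definition torsion_free (V : zmodType) := forall n (x : V), x *+ n.+1 = 0 -> x = 0.

Lemma torsion_free_ffun (D : finType) (V : zmodType) :
  torsion_free V -> torsion_free {ffun D -> V}.
Proof.
move=> tf n w wn; apply/ffunP => d; rewrite [RHS]ffunE; apply: (tf n).
by move/ffunP/(_ d): wn; rewrite ffunMnE ffunE.
Qed.

Section Dominance.
Variables (D : finType) (J : Type) (L : seq J) (sgn : J -> D -> bool) (f : J -> D -> D).
Variable n : nat.
Hypothesis dom : (size L < n)%N.

Let M : 'M[int]_#|D| := \matrix_(i, j) ((i == j)%:R *+ n +
  \sum_(l <- L) sg (sgn l (enum_val i)) (enum_rank (f l (enum_val i)) == j)%:R).

Lemma dominant_mxE (V : zmodType) (v : 'I_#|D| -> V) i :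
  \sum_j v j *~ M i j =
  v i *+ n + \sum_(l <- L) sg (sgn l (enum_val i)) (v (enum_rank (f l (enum_val i)))).
Proof.
have delta k : \sum_j v j *~ (k == j)%:R = v k.
  rewrite (bigD1 k) //= eqxx mulr1z big1 ?addr0 // => j /negPf jk.
  by rewrite eq_sym jk mulr0z.
under eq_bigr => j _ do rewrite mxE mulrzDr mulrz_sumr.
rewrite big_split /= exchange_big /=; congr (_ + _).
  under eq_bigr => j _ do rewrite -mulr_natr mulrzA mulrz_nat.
  rewrite sumrMnl; congr (_ *+ _); exact: delta.
apply: eq_bigr => l _; rewrite -[in RHS](delta (enum_rank _)) sg_sum.
by apply: eq_bigr => j _; case: (sgn _ _) => //=; rewrite mulrNz.
Qed.

(** Over the rationals, look at the equation of a kernel vector at a coordinate of largest absolute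
    value: the diagonal term has weight [n], the others together at most [size L]. *)
Lemma dominant_det : \det M != 0.
Proof.
rewrite -(intr_eq0 rat) -det_map_mx -det_tr; apply/det0P => -[u u0 uM].
have [i ui] : exists i, u 0 i != 0.
  by move/rV0Pn: u0.
pose k := [arg max_(j > i) `|u 0 j|]%O.
have [kmax] : (forall j, `|u 0 j| <= `|u 0 k|) /\ 0 < `|u 0 k|.
  rewrite /k; case: arg_maxP => //= k' _ km; split=> [j|]; first exact: km.
  by apply: lt_le_trans (km i isT); rewrite normr_gt0.
move=> uk; have := dominant_mxE (fun j => u 0 j) k.
have -> : \sum_j u 0 j *~ M k j = 0.
  transitivity ((u *m (map_mx intr M)^T) 0 k); last by rewrite uM mxE.
  rewrite [RHS]mxE; apply: eq_bigr => j _.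
  by rewrite [in RHS]mxE [in RHS]mxE mulrzr.
move/esym/eqP; rewrite addr_eq0 => /eqP /(congr1 Num.norm).
rewrite normrN normrMn => E.
have : `|u 0 k| *+ n <= `|u 0 k| *+ size L.
  rewrite E (le_trans (ler_norm_sum _ _ _)) // -sum1_size -sumrMnr.
  apply: ler_sum => l _; rewrite /sg; case: ifP => _; rewrite ?normrN; exact: kmax.
by rewrite leNgt ltr_pMn2l ?dom.
Qed.

(** The system has an integer matrix, so it makes sense in any abelian group. The adjugate reduces
    it to multiplication by a nonzero determinant, which torsion-freeness cancels without dividing
    in [V]. *)
Lemma dominance (V : zmodType) (v : {ffun D -> V}) : torsion_free V ->
  (forall d, v d *+ n + \sum_(l <- L) sg (sgn l d) (v (f l d)) = 0) -> v = 0.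
Proof.
move=> tf v0; pose vv (i : 'I_#|D|) : V := v (enum_val i).
have Mv i : \sum_j vv j *~ M i j = 0.
  rewrite dominant_mxE /vv -[RHS](v0 (enum_val i)); congr (_ + _).
  by apply: eq_bigr => l _; rewrite enum_rankK.
have dv k : vv k *~ \det M = 0.
  transitivity (\sum_j vv j *~ ((\adj M *m M) k j)).
    rewrite mul_adj_mx (bigD1 k) //= !mxE eqxx mulr1n big1 ?addr0 // => j /negPf jk.
    by rewrite !mxE eq_sym jk mulr0z.
  under eq_bigr => j _ do rewrite mxE mulrz_sumr.
  rewrite exchange_big big1 //= => i _.
  under eq_bigr => j _ do rewrite mulrC mulrzA.
  by rewrite -mulrz_suml Mv mul0rz.
apply/ffunP => d; rewrite ffunE -[d]enum_rankK -/(vv _).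
have := dv (enum_rank d); have := dominant_det.
case: (\det M) => -[|m] // _; rewrite -?pmulrn; first exact: tf.
all: by rewrite NegzE mulrNz -pmulrn => /eqP; rewrite oppr_eq0 => /eqP; exact: tf.
Qed.
End Dominance.

(** * Casimir-nilpotent tensors are invariant *)

Section Core.
Variables (I T : finType) (par : I -> bool) (pos : T -> nat) (kap : T -> bool).
Hypothesis pos_inj : injective pos.
Notation D := {ffun T -> I}.
Variable B : pzRingType.
Hypothesis Btf : torsion_free B.
Variables (g g' : I -> I -> B).
Hypotheses (gg : supercomm par g g) (gg' : supercomm par g g').
Hypotheses (g'g : supercomm par g' g) (g'g' : supercomm par g' g').
Hypothesis mulgV : forall a b, mulc g g' a b = (a == b)%:R.
Variable delta : nat.
Hypothesis sdim : \sum_i sg (par i) (1 : int) = delta%:Z.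
Implicit Types (w : {ffun D -> B}) (l : seq T) (t s u v : T).

Notation omega := (@omega I T par pos kap B).
Notation casimir := (@casimir I T par pos kap B).
Notation e := (@gl_unit I T par pos kap B).
Notation y := (@gl_sum I T par pos kap B).
Notation grp := (@grp I T par pos kap B g g').
Notation grps := (@grps I T par pos kap B g g').

Lemma sdim_scale w : \sum_i sg (par i) w = w *+ delta.
Proof.
rewrite pmulrn -sdim mulrz_sumr; apply: eq_bigr => i _.
by case: (par i); rewrite /sg ?mulrNz mulr1z.
Qed.

Lemma grps_cat l l' w : grps (l ++ l') w = grps l (grps l' w).
Proof. exact: foldr_cat. Qed.

Lemma grp_grps t l w : t \notin l -> grp t (grps l w) = grps l (grp t w).
Proof.
elim: l => //= u l IH; rewrite inE negb_or => /andP[tu tl].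
by rewrite (grpC _ pos_inj) // IH.
Qed.

Lemma grps_perm l l' w : uniq l -> perm_eq l l' -> grps l w = grps l' w.
Proof.
elim: l l' => [|t l IH] l'; first by move=> _; rewrite perm_sym => /perm_nilP ->.
move=> /= /andP[tl ul] pl; have tl' : t \in l' by rewrite -(perm_mem pl) mem_head.
have ul' : uniq l' by rewrite -(perm_uniq pl) /= tl.
case/splitPr: l' / tl' => a b in pl ul' *.
rewrite (IH (a ++ b)) //; last by rewrite -(perm_cons t); apply: perm_trans pl _; rewrite -[t :: b]cat1s perm_catCA.
rewrite !grps_cat /= grp_grps //; move: ul'; rewrite cat_uniq /= => /and3P[_ /norP[]].
by [].
Qed.

Lemma perm_enum2 u v : u != v -> perm_eq (enum T) [:: u, v & rem v (rem u (enum T))].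
Proof.
move=> uv; have uT : u \in enum T by rewrite mem_enum.
rewrite (permPl (perm_to_rem uT)) perm_cons; apply: perm_to_rem.
by rewrite mem_rem_uniq ?enum_uniq // inE /= eq_sym uv mem_enum.
Qed.

Lemma grps_same u v w : u != v -> kap u = kap v ->
  grps (enum T) (omega u v w) = omega u v (grps (enum T) w).
Proof.
move=> uv kuv; have puv := perm_enum2 uv.
rewrite !(grps_perm _ (enum_uniq T) puv) /=.
have := enum_uniq T; rewrite (perm_uniq puv) /=.
move: (rem _ _) => l /and3P[]; rewrite inE negb_or => /andP[_ ul] vl _.
suff -> : grps l (omega u v w) = omega u v (grps l w) by apply: grp_same2.
elim: l ul vl => //= t l IH; rewrite !inE !negb_or => /andP[ut ul] /andP[vt vl].
by rewrite IH // grp_same // eq_sym.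
Qed.

Definition flat_pairs (ds : seq (T * T)) := flatten [seq [:: d.1; d.2] | d <- ds].

(** Since [omega] squares to [- delta] times itself on such a pair, this eigenvalue equation holds
    on the image of the contraction, and it says that [w] carries the canonical invariant in these
    two slots up to the factor [delta]. *)
Definition contracted (ds : seq (T * T)) w :=
  forall d, d \in ds -> omega d.1 d.2 w = - (w *+ delta).

Definition matching_state (p q : seq T) (ds : seq (T * T)) :=
  [/\ perm_eq (p ++ q ++ flat_pairs ds) (enum T), all (fun t => ~~ kap t) p, all kap q &
      all (fun d => [&& d.1 != d.2, ~~ kap d.1 & kap d.2]) ds].

Lemma mem_flat_pairs d ds : d \in ds -> (d.1 \in flat_pairs ds) * (d.2 \in flat_pairs ds).
Proof.
by move=> dd; split; apply/flatten_mapP; exists d => //; rewrite !inE eqxx ?orbT.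
Qed.

Lemma matching_state_disj p q ds x d : matching_state p q ds -> x \in p ++ q -> d \in ds ->
  (x != d.1) * (x != d.2).
Proof.
case=> pT _ _ _ xpq /mem_flat_pairs[d1 d2]; have := enum_uniq T.
rewrite -(perm_uniq pT) catA cat_uniq => /and3P[_ /hasPn h _].
by split; apply: contraTneq xpq => ->; apply: h.
Qed.

Lemma contracted_gl_unit p q ds x i j w : matching_state p q ds -> x \in p ++ q ->
  contracted ds w -> contracted ds (e x i j w).
Proof.
move=> st xpq cw d dd; have [x1 x2] := matching_state_disj st xpq dd.
by rewrite -gl_unit_omega // cw // raddfN raddfMn.
Qed.

Lemma gl_unit_pair0 ds d i j w : (size ds <= delta)%N -> d \in ds -> 
  [&& d.1 != d.2, ~~ kap d.1 & kap d.2] -> contracted ds w ->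
  e d.1 i j w + e d.2 i j w = 0.
Proof.
move=> sz dd /and3P[d12 k1 k2] cw; have := cw d dd.
(* A contracted pair exists, so the bound on [size ds] makes [delta] positive; the eigenvalue
   equation can then be used by cancelling [delta]. *)
have : (0 < delta)%N by apply: leq_trans sz; case: ds dd {cw}.
case: delta => // n _ H; apply: (torsion_free_ffun Btf (n := n)).
rewrite mulrnDl -!raddfMn -[w *+ _]opprK -H !raddfN -opprD.
by rewrite gl_unit_omega_pair // oppr0.
Qed.

Lemma gl_sum_rem p q ds i j w : (size ds <= delta)%N -> matching_state p q ds -> contracted ds w ->
  y i j w = \sum_(x <- p ++ q) e x i j w.
Proof.
move=> sz [pT _ _ /allP dk] cw.
transitivity (\sum_(x <- enum T) e x i j w); first by rewrite big_enum.
rewrite -(perm_big _ pT) /= catA big_cat /=.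
rewrite (_ : \sum_(x <- flat_pairs ds) _ = 0) ?addr0 // big_flatten big_map big1_seq //=.
move=> d dd; rewrite big_cons big_seq1; apply: gl_unit_pair0 sz dd (dk _ dd) cw.
Qed.

Lemma casimir_rem p q ds w : (size ds <= delta)%N -> matching_state p q ds -> contracted ds w ->
  casimir w = \sum_(x <- p ++ q) \sum_(z <- p ++ q) omega z x w.
Proof.
move=> sz st cw; under [RHS]eq_bigr => x _ do rewrite exchange_big.
rewrite /= exchange_big; apply: eq_bigr => i _.
under eq_bigr => x _ do rewrite exchange_big.
rewrite /= exchange_big; apply: eq_bigr => j _.
rewrite (gl_sum_rem j i sz st cw) raddf_sum sg_sum big_seq [RHS]big_seq.
apply: eq_bigr => x xpq; rewrite /= (gl_sum_rem i j sz st) ?sg_sum //.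
exact: contracted_gl_unit st xpq cw.
Qed.

Definition offdiag l := [seq (z, x) | z <- l, x <- rem z l].

Lemma size_offdiag l : size (offdiag l) = (size l * (size l).-1)%N.
Proof.
rewrite size_allpairs_dep sumnE big_map big_seq.
rewrite (eq_bigr (fun=> (size l).-1)) => [|z zl]; last by rewrite size_rem.
by rewrite -big_seq big_const_seq count_predT iter_addn_0 mulnC.
Qed.

Lemma sum_offdiag l w : \sum_(z <- l) \sum_(x <- l) omega z x w =
  w *+ (size l * delta) + \sum_(d <- offdiag l) omega d.1 d.2 w.
Proof.
rewrite big_allpairs_dep /= -sum1_size big_distrl /= -sumrMnr -big_split /=.
rewrite big_seq [RHS]big_seq; apply: eq_bigr => z zl.
by rewrite (big_rem z) //= mul1n (omega_diag _ _ sdim_scale).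
Qed.

(** This is 2 H when [p] and [q] both have f elements: [offdiag] lists ordered pairs, so each
    transposition occurs twice. *)
Definition same_part p q w := w *+ (size p * delta + size q * delta) +
  \sum_(d <- offdiag p ++ offdiag q) omega d.1 d.2 w.

Lemma offdiag_same p q ds d : matching_state p q ds -> d \in offdiag p ++ offdiag q ->
  d.1 != d.2 /\ kap d.1 = kap d.2.
Proof.
case=> pT /allP kp /allP kq _; have := enum_uniq T; rewrite -(perm_uniq pT).
rewrite !cat_uniq => /and5P[up _ uq _ _].
rewrite mem_cat => /orP[] /allpairsPdep[z [x [zl xl ->]]] /=; move: (xl);
 rewrite mem_rem_uniq // inE => /andP[xz xl']; rewrite eq_sym xz.
  by rewrite (negPf (kp _ zl)) (negPf (kp _ xl')).
by rewrite (kq _ zl) (kq _ xl').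
Qed.

Lemma same_part_inj p q ds w : size p = size q -> (0 < size p <= delta)%N -> matching_state p q ds ->
  same_part p q w = 0 -> w = 0.
Proof.
move=> spq /andP[p0 pd] st H0.
apply: (@dominance _ _ (offdiag p ++ offdiag q)
   (fun d x => swap_sign par pos x d.1 d.2) (fun d x => swap x d.1 d.2)
   (size p * delta + size q * delta) _ _ w Btf).
  rewrite size_cat !size_offdiag -spq !addnn ltn_double ltn_pmul2l //.
  by case: (size p) p0 pd.
move=> x; rewrite -[RHS](ffunE (fun=> 0) x); have <- : (0 : {ffun D -> B}) = [ffun=> 0].
  by apply/ffunP => z; rewrite !ffunE.
rewrite -H0 ffunE ffunMnE sum_ffunE; congr (_ + _).
rewrite big_seq [RHS]big_seq; apply: eq_bigr => d dd.
have [d12 k12] := offdiag_same st dd; by rewrite omega_same.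
Qed.

Lemma grps_same_part p q ds w : matching_state p q ds ->
  grps (enum T) (same_part p q w) = same_part p q (grps (enum T) w).
Proof.
move=> st; rewrite raddfD raddfMn; congr (_ + _).
rewrite raddf_sum big_seq [RHS]big_seq; apply: eq_bigr => d dd.
have [d12 k12] := offdiag_same st dd; exact: grps_same.
Qed.

Lemma same_part_additive p q : zmod_morphism (same_part p q).
Proof.
move=> w w'; rewrite /same_part mulrnBl (eq_bigr _ (fun d _ => raddfB (omega d.1 d.2) w w')).
by rewrite sumrB opprD addrACA.
Qed.
HB.instance Definition _ p q := GRing.isZmodMorphism.Build _ _ (same_part p q) (same_part_additive p q).

(** The identity C = 2 H - 2 K on tensors whose other slots are contracted: a mixed [omega] is minus
    a contraction, and the two orders of a mixed pair agree by [omegaC]. *)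
Lemma casimir_same_part p q ds w : (size ds <= delta)%N -> matching_state p q ds -> contracted ds w ->
  casimir w = same_part p q w + (\sum_(z <- p) \sum_(x <- q) omega z x w) *+ 2.
Proof.
move=> sz st cw; rewrite (casimir_rem sz st cw) exchange_big big_cat /=.
under eq_bigr => z _ do rewrite big_cat.
under [X in _ + X]eq_bigr => z _ do rewrite big_cat.
rewrite !big_split /= !sum_offdiag.
have -> : \sum_(z <- q) \sum_(x <- p) omega z x w = \sum_(z <- p) \sum_(x <- q) omega z x w.
  rewrite exchange_big big_seq [RHS]big_seq; apply: eq_bigr => z zp.
  rewrite big_seq [RHS]big_seq; apply: eq_bigr => x xq; apply: omegaC => //.
  have [_ /allP kp /allP kq _] := st.
  by apply: contraTneq (kq _ xq) => ->; apply: kp.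
rewrite /same_part big_cat mulrnDr mulr2n /=.
move: (\sum_(z <- p) _) (\sum_(d <- offdiag p) _) (\sum_(d <- offdiag q) _) => a b c.
by rewrite [a + (_ + c)]addrC [LHS]addrACA addrA addrACA !addrA.
Qed.

(* [ds] lists the pairs of slots already contracted, [p] and [q] the remaining
   slots of the two kinds. *)
Theorem casimir_nilp_invariant p q ds w j : size p = size q ->
  (size p + size ds <= delta)%N -> matching_state p q ds -> contracted ds w ->
  iter j casimir w = 0 -> grps (enum T) w = w.
Proof.
move Ef : (size p) => f; elim: f p q ds w j Ef => [|f IHf] p q ds w j Ep Eq sz st cw Cw.
  (* No slot remains, so the group acts pair by pair: [delta] times [w] is minus the image of
     [omega], which [grp_opp] fixes. *)
  have [pT _ _ /allP dk] := st.
  move: pT; rewrite (size0nil Ep) (size0nil (esym Eq)) /= => pT.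
  rewrite -(grps_perm w _ pT) ?(perm_uniq pT) ?enum_uniq //.
  have : {subset ds <= ds} by [].
  elim: {1 3}ds => //= d l IH sub.
  rewrite IH => [|z zl]; last by apply: sub; rewrite inE zl orbT.
  have dd : d \in ds by apply: sub; rewrite inE eqxx.
  have /and3P[d12 k1 k2] := dk d dd; have H := cw d dd.
  have : (0 < delta)%N by apply: leq_trans sz; case: (ds) dd.
  case: (delta) H => // n H _; apply/eqP; rewrite -subr_eq0; apply/eqP.
  apply: (torsion_free_ffun Btf (n := n)).
  rewrite mulrnBl -!raddfMn -[w *+ _]opprK -H !raddfN /= grp_opp //.
  by rewrite subrr.
elim: j w cw Cw => [|j IHj] w cw Cw; first by have -> : w = 0 := Cw; rewrite raddf0.
have szd : (size ds <= delta)%N by apply: leq_trans sz; rewrite leq_addl.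
have [pT kp kq kd] := st.
(* The vector C w is killed by one power of C less and is still contracted, since C commutes with
   the contractions. *)
have gC : grps (enum T) (casimir w) = casimir w.
  apply: IHj; last by rewrite -iterSr.
  move=> d dd; have /and3P[d12 k1 k2] := allP kd _ dd.
  by rewrite -casimir_omega_pair // cw // raddfN raddfMn.
(* Here the exponent does not drop, but the new pair [(z, x)] leaves one remaining pair fewer; this
   is why the outer induction quantifies over all exponents. *)
have gK z x : z \in p -> x \in q -> grps (enum T) (omega z x w) = omega z x w.
  move=> zp xq; have kz := allP kp _ zp; have kx := allP kq _ xq.
  have zx : z != x by apply: contraNneq kz => ->.
  apply: (IHf (rem z p) (rem x q) ((z, x) :: ds) _ j.+1).
  - by rewrite size_rem // Ep.
  - by rewrite size_rem // -Eq.
  - by rewrite /= addnS.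
  - split.
    + rewrite -(permPr pT) perm_sym; apply: perm_trans (perm_cat (perm_to_rem zp) (perm_cat (perm_to_rem xq) (perm_refl _))) _.
      rewrite /= perm_sym; apply/permP => P; rewrite /flat_pairs /= !count_cat /= !count_cat /=.
      lia.
    + by apply/allP => t /mem_rem /(allP kp).
    + by apply/allP => t /mem_rem /(allP kq).
    + by rewrite /= zx kz kx.
  - move=> d; rewrite inE => /predU1P[->|dd] /=.
      by rewrite (omega_sqr_pair pos_inj sdim_scale).
    have zpq : z \in p ++ q by rewrite mem_cat zp.
    have xpq : x \in p ++ q by rewrite mem_cat xq orbT.
    have [z1 z2] := matching_state_disj st zpq dd; have [x1 x2] := matching_state_disj st xpq dd.
    by rewrite omega_omega 1?eq_sym // cw // raddfN raddfMn.
  - have C1 i : iter i casimir (omega z x w) = omega z x (iter i casimir w).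
      by elim: i => //= i ->; rewrite casimir_omega_pair.
    by rewrite C1 Cw raddf0.
have HE := casimir_same_part szd st cw.
have gH : grps (enum T) (same_part p q w) = same_part p q w.
  have -> : same_part p q w = casimir w - (\sum_(z <- p) \sum_(x <- q) omega z x w) *+ 2.
    by rewrite HE addrK.
  rewrite raddfB raddfMn /= gC; congr (_ - _ *+ 2).
  rewrite raddf_sum big_seq [RHS]big_seq; apply: eq_bigr => z zp.
  by rewrite raddf_sum big_seq [RHS]big_seq; apply: eq_bigr => x xq; apply: gK.
(* 2 H commutes with the group and 2 H w is invariant, so 2 H kills the difference of the transform
   of [w] and [w]; injectivity finishes. *)
apply/eqP; rewrite -subr_eq0; apply/eqP; apply: (same_part_inj _ _ st).
- by rewrite Ep.
- by rewrite Ep /= (leq_trans _ sz) // leq_addr.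
- by rewrite raddfB /= -(grps_same_part _ st) gH subrr.
Qed.
End Core.

(** * Endomorphisms as tensors *)

Section Kernels.
Variables (I T : finType) (par : I -> bool) (pos : T -> nat) (kap : T -> bool).
Variable B : pzRingType.
Notation A := {ffun T -> I}.
Implicit Types (a b c : A) (v : {ffun A -> B}).

Definition basis b : {ffun A -> B} := [ffun c => (c == b)%:R].
(** Slot operators multiply coefficients from the left, so over a noncommutative [B] they are linear
    for multiplication from the right. *)
Definition scaler v (r : B) : {ffun A -> B} := [ffun c => v c * r].
Definition kernel (F : {ffun A -> B} -> {ffun A -> B}) a b := F (basis b) a.
Definition mulk (x z : A -> A -> B) a b := \sum_c x a c * z c b.

Lemma basis_expand v : v = \sum_b scaler (basis b) (v b).
Proof.
apply/ffunP => c; rewrite sum_ffunE (bigD1 c) //= !ffunE eqxx mul1r big1 ?addr0 //.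
by move=> b bc; rewrite !ffunE eq_sym (negPf bc) mul0r.
Qed.

Lemma kernelE (F : {additive {ffun A -> B} -> {ffun A -> B}}) v a :
  (forall v r, F (scaler v r) = scaler (F v) r) ->
  F v a = \sum_b kernel F a b * v b.
Proof.
move=> Fr; rewrite {1}(basis_expand v) raddf_sum sum_ffunE; apply: eq_bigr => b _.
by rewrite Fr ffunE.
Qed.

Lemma slotop_scaler t (c : I -> I -> B) v r :
  slotop par pos kap t c (scaler v r) = scaler (slotop par pos kap t c v) r.
Proof.
apply/ffunP => d; rewrite !ffunE mulr_suml; apply: eq_bigr => i _.
by rewrite ffunE sgMl mulrA.
Qed.

Lemma grps_scaler g g' l v r :
  grps par pos kap g g' l (scaler v r) = scaler (grps par pos kap g g' l v) r.
Proof. by elim: l => //= t l ->; rewrite /grp slotop_scaler. Qed.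

Lemma gl_sum_scaler i j v r : gl_sum par pos kap i j (scaler v r) = scaler (gl_sum par pos kap i j v) r.
Proof.
rewrite /gl_sum; apply/ffunP => d; rewrite sum_ffunE ffunE sum_ffunE mulr_suml.
by apply: eq_bigr => t _; rewrite /gl_unit slotop_scaler ffunE.
Qed.

Lemma kernel_slotop t (c : I -> I -> B) a b : kernel (slotop par pos kap t c) a b =
  if upd a t (b t) == b then sg (slot_sign par pos kap t a (b t)) (c (a t) (b t)) else 0.
Proof.
rewrite /kernel ffunE (bigD1 (b t)) //= big1 ?addr0; last first.
  move=> i ib; rewrite ffunE; case: eqP => [ab|_]; last by rewrite mulr0 sg0.
  by rewrite -ab upd_same eqxx in ib.
by rewrite ffunE; case: eqP => _; rewrite ?mulr1 // mulr0 sg0.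
Qed.

Lemma mulk_slotop x t (c : I -> I -> B) a b : mulk x (kernel (slotop par pos kap t c)) a b =
  \sum_i x a (upd b t i) * sg (slot_sign par pos kap t (upd b t i) (b t)) (c i (b t)).
Proof.
rewrite /mulk (bigID (fun e : A => upd b t (e t) == e)) /= addrC big1 => [|e ebt].
  rewrite add0r (reindex_onto (upd b t) (fun e : A => e t)) => [|e /eqP //].
  apply: eq_big => [i|i _]; first by rewrite upd_same !eqxx.
  by rewrite kernel_slotop upd_same upd_upd upd_id eqxx.
rewrite kernel_slotop ifN ?mulr0 //; apply: contra ebt => /eqP <-.
by rewrite upd_upd upd_id.
Qed.

End Kernels.

(** * Supermatrices as tensors with 2 N slots *)

Section Vec.
Variables (I : finType) (par : I -> bool) (N : nat) (kapM : 'I_N -> bool).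
Notation A := {ffun 'I_N -> I}.
Notation TW := ('I_N + 'I_N)%type.
Notation D := {ffun TW -> I}.
Notation posM := (@nat_of_ord N).
Implicit Types (a b : A) (d : D) (t : 'I_N).
Notation p i j := (par i (+) par j).

(** The [inl] slots carry the column index, stand on the left and have their type flipped by [kapW];
    the [inr] slots carry the row index and keep the order and type they have in M. *)
Definition posW (t : TW) : nat := match t with inl t => t | inr t => N + t end.
Definition kapW (t : TW) := match t with inl t => ~~ kapM t | inr t => kapM t end.

Lemma posW_inj : injective posW.
Proof.
move=> [t|t] [s|s] /= h.
- by congr inl; apply: val_inj.
- by have := ltn_ord t; lia.
- by have := ltn_ord s; lia.
- by congr inr; apply: val_inj => /=; lia.
Qed.

Definition lft d : A := [ffun t => d (inl t)].
Definition rgt d : A := [ffun t => d (inr t)].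
Definition glue a b : D := [ffun t => match t with inl t => b t | inr t => a t end].

Lemma lft_glue a b : lft (glue a b) = b.
Proof. by apply/ffunP => t; rewrite !ffunE. Qed.
Lemma rgt_glue a b : rgt (glue a b) = a.
Proof. by apply/ffunP => t; rewrite !ffunE. Qed.

Definition tot a : bool := \big[addb/false]_t par (a t).
Definition oddslots a : nat := \sum_t par (a t).
(* The sign identifying the supermatrix [x] with a tensor: with c odd slots it is
   (-1)^(c (c + 1) / 2), and dual slots of M become double duals, which costs
   one more sign per odd index. *)
Definition sigma b : bool :=
  odd (uphalf (oddslots b)) (+) \big[addb/false]_(t | kapM t) par (b t).

Lemma tot_odd a : tot a = odd (oddslots a).
Proof.
by rewrite (big_morph odd oddD (erefl _)); apply: eq_bigr => t _; rewrite oddb.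
Qed.

Lemma tot_upd a t i : tot (upd a t i) = tot a (+) (par (a t) (+) par i).
Proof.
rewrite /tot (bigD1 t) //= upd_same [in RHS](bigD1 t) //=.
rewrite (eq_bigr (fun x => par (a x))) => [|x xt]; last by rewrite upd_other.
by case: (par i); case: (par (a t)); case: (\big[_/_]_(_ | _) _).
Qed.

(** Raising or lowering the number c of odd slots by one changes c (c + 1) / 2 by c + 1 or by c, so
    the sign changes according to the total parity. This compensates for a column slot having to
    pass all the other column slots in [slotW_inl]. *)
Lemma sigma_upd b t i : sigma (upd b t i) = sigma b (+)
  ((par (b t) (+) par i) && (par (b t) (+) tot b (+) ~~ kapM t)).
Proof.
rewrite tot_odd /sigma; set X := \big[_/_]_(_ | _) _; set Y := \big[_/_]_(_ | _) _.
have -> : X = Y (+) (kapM t && (par (b t) (+) par i)).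
  rewrite /X /Y; case: (boolP (kapM t)) => kt.
    rewrite (bigD1 t) //= upd_same [in RHS](bigD1 t) //=.
    rewrite (eq_bigr (fun x => par (b x))) => [|x /andP[_ xt]]; last by rewrite upd_other.
    by case: (par i); case: (par (b t)); case: (\big[_/_]_(_ | _) _).
  rewrite addbF; apply: eq_bigr => x kx; rewrite upd_other //.
  by apply: contraTneq kx => ->.
set r := (\sum_(x < N | x != t) par (b x))%N.
have -> : oddslots (upd b t i) = (par i + r)%N.
  rewrite /oddslots (bigD1 t) //= upd_same; congr (_ + _)%N.
  by apply: eq_bigr => x xt; rewrite upd_other.
have -> : oddslots b = (par (b t) + r)%N by rewrite /oddslots (bigD1 t).
have H : odd (uphalf r.+1) = odd (uphalf r) (+) ~~ odd r.
  by rewrite (uphalfE r.+1) /= uphalf_half oddD oddb /=; case: (odd r); case: (odd _).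
move: H; case: (par i); case: (par (b t)); rewrite /= ?add0n ?add1n => H;
  rewrite ?H; case: (kapM t); case: (odd r); case: Y; case: (odd _) => //.
Qed.

Section Ring.
Variable B : pzRingType.
Implicit Types (x : A -> A -> B).
Notation slotW := (slotop par posW kapW).
Notation slotM := (slotop par posM kapM).
Notation basis := (@basis I 'I_N B).

Definition vec x : {ffun D -> B} := [ffun d => sg (sigma (lft d)) (x (rgt d) (lft d))].

Lemma eq_vec x z : (forall a b, x a b = z a b) -> vec x = vec z.
Proof. by move=> xz; apply/ffunP => d; rewrite !ffunE xz. Qed.

Lemma vec_inj x z : vec x = vec z -> forall a b, x a b = z a b.
Proof.
move=> xz a b; have := congr1 (fun w : {ffun D -> B} => w (glue a b)) xz.
rewrite !ffunE lft_glue rgt_glue.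
by move/(congr1 (sg (sigma b))); rewrite !sg_sg addbb.
Qed.

Lemma upd_inl d t i : (lft (upd d (inl t) i) = upd (lft d) t i) * (rgt (upd d (inl t) i) = rgt d).
Proof. by split; apply/ffunP => s; rewrite !ffunE. Qed.
Lemma upd_inr d t i : (rgt (upd d (inr t) i) = upd (rgt d) t i) * (lft (upd d (inr t) i) = lft d).
Proof. by split; apply/ffunP => s; rewrite !ffunE. Qed.

Lemma after_inr d t : after par posW (inr t) d = after par posM t (rgt d).
Proof.
rewrite /after big_sumType /= big_pred0 => [|s]; last first.
  by apply/negbTE; rewrite -leqNgt; have := ltn_ord s; lia.
rewrite addFb; apply: eq_big => s; first by rewrite ltn_add2l.
by rewrite ffunE.
Qed.

Lemma after_inl d t : after par posW (inl t) d = after par posM t (lft d) (+) tot (rgt d).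
Proof.
rewrite /after big_sumType /=; congr (_ (+) _); first by apply: eq_bigr => s _; rewrite ffunE.
apply: eq_big => s; last by rewrite ffunE.
by rewrite (leq_trans (ltn_ord t)) // leq_addr.
Qed.

Lemma vecE x d : vec x d = sg (sigma (lft d)) (x (rgt d) (lft d)).
Proof. exact: ffunE. Qed.

Definition colk x b : {ffun A -> B} := [ffun a => x a b].

Lemma colkE x b a : colk x b a = x a b.
Proof. exact: ffunE. Qed.

Lemma slotW_inr t (c : I -> I -> B) x : slotW (inr t) c (vec x) =
  vec (fun a b => slotM t c (colk x b) a).
Proof.
apply/ffunP => d; rewrite vecE !slotopE sg_sum; apply: eq_bigr => i _.
rewrite vecE colkE !upd_inr sgMr !sg_sg /slot_sign after_inr /= addbC.
by rewrite !(ffunE (fun t => d (inr t))).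
Qed.

(** Acting on a column slot is right multiplication. [th] measures the parity of [x] not borne by
    its entries: [false] when the entries supercommute with [c] according to their position, the
    parity of [x] when they are scalars. *)
Lemma slotW_inl (th : bool) t (c : I -> I -> B) x :
  (forall i j a b, c i j * x a b = sg (p i j && (tot a (+) tot b (+) th)) (x a b * c i j)) ->
  slotW (inl t) (fun i j => c j i) (vec x) = vec (fun a b =>
    \sum_i sg (p i (b t) && th)
      (x a (upd b t i) * sg (slot_sign par posM kapM t (upd b t i) (b t)) (c i (b t)))).
Proof.
move=> cx; apply/ffunP => d; rewrite vecE slotopE sg_sum; apply: eq_bigr => i _.
rewrite vecE !upd_inl !sgMr cx !sg_sg !(ffunE (fun t => d (inl t))); congr (sg _ _).
rewrite /slot_sign after_inl /= sigma_upd tot_upd after_upd upd_same ltnn.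
rewrite !(ffunE (fun t => d (inl t))).
case: (par (d (inl t))); case: (par i); rewrite //= ?addbF //;
case: (kapM t); case: (sigma _); case: (after _ _ _ _); case: (tot _);
  case: (tot _); case: th {cx} => //.
Qed.

End Ring.
End Vec.

(** * Change of the coefficient ring *)

Section MapSlots.
Variables (I T : finType) (par : I -> bool) (pos : T -> nat) (kap : T -> bool).
Variables (B B' : pzRingType) (f : {rmorphism B -> B'}).
Notation D := {ffun T -> I}.
Implicit Types (w : {ffun D -> B}).

Definition mapf w : {ffun D -> B'} := [ffun d => f (w d)].

Lemma mapf_is_additive : zmod_morphism mapf.
Proof. by move=> w w'; apply/ffunP => d; rewrite !ffunE rmorphB. Qed.
HB.instance Definition _ := GRing.isZmodMorphism.Build _ _ mapf mapf_is_additive.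

Lemma mapf_slotop t (c : I -> I -> B) (c' : I -> I -> B') w :
  (forall i j, f (c i j) = c' i j) ->
  mapf (slotop par pos kap t c w) = slotop par pos kap t c' (mapf w).
Proof.
move=> cc; apply/ffunP => d; rewrite ffunE !slotopE rmorph_sum; apply: eq_bigr => i _.
by rewrite raddf_sg /= rmorphM cc ffunE.
Qed.

Lemma mapf_basis b : mapf (basis B b) = basis B' b.
Proof. by apply/ffunP => d; rewrite !ffunE rmorph_nat. Qed.

Lemma mapf_grps (g g' : I -> I -> B) (h h' : I -> I -> B') l w :
  (forall i j, f (g i j) = h i j) -> (forall i j, f (g' i j) = h' i j) ->
  mapf (grps par pos kap g g' l w) = grps par pos kap h h' l (mapf w).
Proof.
move=> gh gh'; elim: l => //= t l <-; apply: mapf_slotop => i j.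
by rewrite /slot_coef; case: (kap t).
Qed.

Lemma mapf_gl_sum i j w : mapf (gl_sum par pos kap i j w) = gl_sum par pos kap i j (mapf w).
Proof.
rewrite raddf_sum; apply: eq_bigr => t _; apply: mapf_slotop => a b.
by rewrite /unit_coef; case: (kap t); rewrite ?rmorphN rmorph_nat.
Qed.

Lemma mapf_casimir w : mapf (casimir par pos kap w) = casimir par pos kap (mapf w).
Proof.
rewrite raddf_sum; apply: eq_bigr => i _; rewrite raddf_sum; apply: eq_bigr => j _.
by rewrite raddf_sg /= !mapf_gl_sum.
Qed.

End MapSlots.

(** * The group acts on supermatrices by multiplication on both sides *)

Section VecLists.
Variables (I : finType) (par : I -> bool) (N : nat) (kapM : 'I_N -> bool).
Notation A := {ffun 'I_N -> I}.
Notation TW := ('I_N + 'I_N)%type.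
Notation D := {ffun TW -> I}.
Notation posM := (@nat_of_ord N).
Notation posW := (@posW N).
Notation kapW := (kapW kapM).
Notation p i j := (par i (+) par j).
Notation tot := (tot par).
Notation sigma := (sigma par kapM).
Variable B : pzRingType.
Implicit Types (a b : A) (d : D) (t : 'I_N) (x z : A -> A -> B).
Notation vec := (@vec I par N kapM B).

Lemma vecL (g g' : I -> I -> B) l x :
  grps par posW kapW g g' (map inr l) (vec x) =
  vec (fun a b => grps par posM kapM g g' l (colk x b) a).
Proof.
elim: l => [|t l IH] /=; first by apply: eq_vec => a b; rewrite colkE.
rewrite IH /grp slotW_inr; apply: eq_vec => a b.
by congr (slotop _ _ _ _ _ _ a); apply/ffunP => a'; rewrite colkE.
Qed.

Lemma mulkA x y z a b : mulk x (mulk y z) a b = mulk (mulk x y) z a b.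
Proof.
rewrite /mulk; under eq_bigr => c _ do rewrite mulr_sumr.
rewrite exchange_big; apply: eq_bigr => c _; rewrite mulr_suml.
by apply: eq_bigr => e _; rewrite mulrA.
Qed.

Lemma eq_mulk x x' z z' : (forall a b, x a b = x' a b) -> (forall a b, z a b = z' a b) ->
  forall a b, mulk x z a b = mulk x' z' a b.
Proof. by move=> xx zz a b; apply: eq_bigr => c _; rewrite xx zz. Qed.

Lemma mulk1 x a b : mulk x (kernel id) a b = x a b.
Proof.
rewrite /mulk (bigD1 b) //= /kernel ffunE eqxx mulr1 big1 ?addr0 //.
by move=> e /negPf eb; rewrite ffunE eb mulr0.
Qed.

Lemma mulk_grps_cat (g g' : I -> I -> B) l l' x a b :
  mulk x (kernel (grps par posM kapM g g' (l ++ l'))) a b =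
  mulk (mulk x (kernel (grps par posM kapM g g' l))) (kernel (grps par posM kapM g g' l')) a b.
Proof.
rewrite -mulkA; apply: eq_mulk => // {}a {}b.
rewrite [LHS]/kernel grps_cat (kernelE (F := grps par posM kapM g g' l)) //.
exact: grps_scaler.
Qed.

(** For an ungraded [B], this is what remains of saying that entry [a], [b] has parity
    [tot a (+) tot b]: its commutation rule with the coefficients [c]. *)
Definition homk (c : I -> I -> B) x := forall i j a b,
  c i j * x a b = sg (p i j && (tot a (+) tot b)) (x a b * c i j).

Lemma homk_grps (g g' : I -> I -> B) l x k :
  supercomm par g g -> supercomm par g g' -> supercomm par g' g -> supercomm par g' g' ->
  homk g x -> homk g' x ->
  homk (slot_coef g g' k) (mulk x (kernel (grps par posM kapM g g' l))).
Proof.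
move=> gg gg' g'g g'g' gx g'x.
have : homk (slot_coef g g' k) x.
  move=> i j a b; rewrite /slot_coef; case: k; first by rewrite g'x addbC.
  exact: gx.
elim: l x {gx g'x} => [|t l IH] x hx; first by move=> i j a b; rewrite !mulk1 hx.
have := IH (mulk x (kernel (grps par posM kapM g g' [:: t]))).
move=> IH1 i j a b; rewrite !(mulk_grps_cat _ _ [:: t]); apply: IH1 => {IH i j a b}.
move=> i j a b; rewrite /= /grp !mulk_slotop mulr_sumr mulr_suml sg_sum.
apply: eq_bigr => i0 _; rewrite mulrA hx sgMl -mulrA.
rewrite !sgMr [slot_coef _ _ _ i j * _](slot_coef_supercomm _ _ gg gg' g'g g'g').
rewrite !sgMr !sg_sg sgMl mulrA sg_sg; congr (sg _ _); rewrite tot_upd.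
by case: (par i0); case: (par (b t)); case: (par i); case: (par j); case: (tot a);
  case: (tot b); case: (slot_sign _ _ _ _ _ _).
Qed.

(** On column slots the type is flipped and [g], [g'] are exchanged, so the effect is right
    multiplication by the matrices of [g]; right multiplications compose in the opposite order,
    whence [rev]. *)
Lemma vecR (g g' : I -> I -> B) l x :
  supercomm par g g -> supercomm par g g' -> supercomm par g' g -> supercomm par g' g' ->
  homk g x -> homk g' x ->
  grps par posW kapW g' g (map inl l) (vec x) =
  vec (mulk x (kernel (grps par posM kapM g g' (rev l)))).
Proof.
move=> gg gg' g'g g'g' gx g'x.
elim: l => [|t l IH] /=; first by apply: eq_vec => a b; rewrite mulk1.
rewrite IH rev_cons -cats1 /grp.
rewrite (_ : slot_coef g' g (~~ kapM t) = fun i j => slot_coef g g' (kapM t) j i); last first.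
  by rewrite /slot_coef; case: (kapM t).
rewrite (@slotW_inl _ _ _ _ _ false); last first.
  by move=> i j a b; rewrite addbF; apply: homk_grps.
apply: eq_vec => a b; under eq_bigr => i _ do rewrite andbF /=.
by rewrite mulk_grps_cat -mulk_slotop.
Qed.

End VecLists.

(** * The Lie superalgebra acts on supermatrices by superbrackets *)

Section VecCasimir.
Variables (I : finType) (par : I -> bool) (N : nat) (kapM : 'I_N -> bool).
Notation A := {ffun 'I_N -> I}.
Notation TW := ('I_N + 'I_N)%type.
Notation D := {ffun TW -> I}.
Notation posM := (@nat_of_ord N).
Notation posW := (@posW N).
Notation kapW := (kapW kapM).
Notation p i j := (par i (+) par j).
Notation tot := (tot par).
Section Ring.
Variable B : pzRingType.
Implicit Types (a b : A) (d : D) (t : 'I_N) (x z : A -> A -> B).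
Notation vec := (@vec I par N kapM B).

Definition hasp th x := forall a b, tot a (+) tot b != th -> x a b = 0.

Definition gl_kernel i j : A -> A -> B := kernel (gl_sum par posM kapM i j).
Definition gl_bracket th i j x a b :=
  mulk (gl_kernel i j) x a b - sg (p i j && th) (mulk x (gl_kernel i j) a b).
(** Meant for even [x]: the inner bracket is taken with parity [false], and its value has the parity
    of the elementary matrix, which is the parity given to the outer bracket. *)
Definition ad_casimir x a b :=
  \sum_i \sum_j sg (par j) (gl_bracket (p i j) i j (gl_bracket false j i x) a b).

Lemma gl_kernelE i j a b : gl_kernel i j a b = \sum_t kernel (gl_unit par posM kapM t i j) a b.
Proof. by rewrite /gl_kernel /kernel /gl_sum sum_ffunE. Qed.

Lemma vecD x z : vec (fun a b => x a b + z a b) = vec x + vec z.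
Proof. by apply/ffunP => d; rewrite !ffunE sgD. Qed.

Lemma vecN x : vec (fun a b => - x a b) = - vec x.
Proof. by apply/ffunP => d; rewrite !ffunE; case: (sigma _ _ _). Qed.

Lemma vec_sg s x : vec (fun a b => sg s (x a b)) = sg s (vec x).
Proof. by case: s => //=; rewrite vecN. Qed.

Lemma vec_sum (J : Type) (l : seq J) (x : J -> A -> A -> B) :
  vec (fun a b => \sum_(k <- l) x k a b) = \sum_(k <- l) vec (x k).
Proof.
by apply/ffunP => d; rewrite sum_ffunE vecE sg_sum; apply: eq_bigr => k _; rewrite vecE.
Qed.

Lemma gl_unit_inr t i j x : gl_unit par posW kapW (inr t) i j (vec x) =
  vec (mulk (kernel (gl_unit par posM kapM t i j)) x).
Proof.
rewrite /gl_unit slotW_inr; apply: eq_vec => a b /=.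
rewrite -/(gl_unit par posM kapM t i j _) (kernelE (F := gl_unit par posM kapM t i j)) //; last first.
  exact: slotop_scaler.
by apply: eq_bigr => c _; rewrite colkE.
Qed.

Lemma gl_unit_inl th t i j x : hasp th x -> gl_unit par posW kapW (inl t) i j (vec x) =
  - sg (p i j && th) (vec (mulk x (kernel (gl_unit par posM kapM t i j)))).
Proof.
move=> hx; pose c (a b : I) : B := - unit_coef B (kapM t) i j a b.
have cpar (a b : I) : c a b != 0 -> p a b = p i j.
  rewrite /c /unit_coef; case: (kapM t);
    by case: (a =P _) => [->|_]; case: (b =P _) => [->|_];
    rewrite /= ?oppr0 ?eqxx // addbC.
transitivity (slotop par posW kapW (inl t) (fun a0 b0 : I => c b0 a0) (vec x)).
  apply: eq_slotop => a0 b0; rewrite /c /unit_coef /=.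
  by case: (kapM t); rewrite /= ?opprK andbC.
rewrite (@slotW_inl _ _ _ _ _ th); last first.
  move=> i' j' a b; case: (eqVneq (c i' j') 0) => [->|/cpar cij].
    by rewrite mul0r mulr0 sg0.
  case: (eqVneq (tot a (+) tot b) th) => [->|/hx ->]; last by rewrite mul0r mulr0 sg0.
  rewrite addbb andbF /= /c /unit_coef.
  by case: (kapM t); rewrite ?mulNr ?mulrN ?opprK;
    case: (_ && _); rewrite ?mulr1 ?mulr0 ?mul1r ?mul0r.
rewrite -vec_sg -vecN; apply: eq_vec => a b; rewrite /gl_unit mulk_slotop sg_sum -sumrN.
apply: eq_bigr => i0 _; rewrite !sgMr !sg_sg /c mulrN -[- (_ * _)]/(sg true _) sg_sg.
rewrite -[- (sg _ _)]/(sg true (sg _ _)) sg_sg.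
case: (eqVneq (c i0 (b t)) 0) => [c0|/cpar ->]; last first.
  by congr (sg _ _); case: (slot_sign _ _ _ _ _ _); case: (_ && th).
by move/eqP: c0; rewrite /c oppr_eq0 => /eqP ->; rewrite mulr0 !sg0.
Qed.

Lemma gl_sum_vec th i j x : hasp th x ->
  gl_sum par posW kapW i j (vec x) = vec (gl_bracket th i j x).
Proof.
move=> hx; rewrite /gl_sum big_sumType /=.
under eq_bigr => t _ do rewrite (gl_unit_inl _ _ _ hx).
under [X in _ + X]eq_bigr => t _ do rewrite gl_unit_inr.
rewrite -vec_sum sumrN -sg_sum -vec_sum -vec_sg -vecN -vecD; apply: eq_vec => a b.
rewrite addrC /gl_bracket; congr (_ - sg _ _).
  rewrite /mulk exchange_big; apply: eq_bigr => c _; rewrite -mulr_suml.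
  by rewrite gl_kernelE.
rewrite /mulk exchange_big; apply: eq_bigr => c _; rewrite -mulr_sumr.
by rewrite gl_kernelE.
Qed.

Lemma hasp_mulk th th' x z : hasp th x -> hasp th' z -> hasp (th (+) th') (mulk x z).
Proof.
move=> hx hz a b ab; rewrite /mulk big1 // => c _.
case: (eqVneq (tot a (+) tot c) th) => [ac|/hx ->]; last by rewrite mul0r.
case: (eqVneq (tot c (+) tot b) th') => [cb|/hz ->]; last by rewrite mulr0.
case/negP: ab; rewrite -ac -cb; by case: (tot a); case: (tot b); case: (tot c).
Qed.

Lemma hasp_gl_kernel i j : hasp (p i j) (gl_kernel i j).
Proof.
move=> a b ab; rewrite gl_kernelE big1 // => t _; rewrite /gl_unit kernel_slotop.
case: eqP => // ub; rewrite (_ : unit_coef _ _ _ _ _ _ = 0) ?sg0 //.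
move: ab; rewrite -{1}ub tot_upd /unit_coef.
case: (kapM t); case: (a t =P _) => [->|_]; case: (b t =P _) => [->|_];
  rewrite /= ?oppr0 //; case: (tot a); case: (par i); by case: (par j).
Qed.

Lemma hasp_gl_bracket th i j x : hasp th x -> hasp (p i j (+) th) (gl_bracket th i j x).
Proof.
move=> hx a b ab; rewrite /gl_bracket (hasp_mulk (hasp_gl_kernel (i:=i) (j:=j)) hx) //.
by rewrite (hasp_mulk hx (hasp_gl_kernel (i:=i) (j:=j))) ?sg0 ?subr0 // [th (+) _]addbC.
Qed.

Lemma hasp_ad_casimir x : hasp false x -> hasp false (ad_casimir x).
Proof.
move=> hx a b ab; rewrite /ad_casimir big1 // => i _; rewrite big1 // => j _.
rewrite (_ : gl_bracket _ _ _ _ _ _ = 0) ?sg0 //.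
have h1 := hasp_gl_bracket (i := j) (j := i) hx; rewrite addbF addbC in h1.
by apply: (hasp_gl_bracket h1); rewrite addbb.
Qed.

Lemma casimir_vec x : hasp false x -> casimir par posW kapW (vec x) = vec (ad_casimir x).
Proof.
move=> hx; rewrite /casimir /ad_casimir vec_sum; apply: eq_bigr => i _; rewrite vec_sum.
apply: eq_bigr => j _; rewrite vec_sg (gl_sum_vec _ _ hx); congr (sg _ _).
have h1 := hasp_gl_bracket (i := j) (j := i) hx; rewrite addbF addbC in h1.
by rewrite (gl_sum_vec _ _ h1).
Qed.

Lemma hasp_iter l x : hasp false x -> hasp false (iter l ad_casimir x).
Proof. by move=> hx; elim: l => //= l IH; apply: hasp_ad_casimir. Qed.

Lemma iter_casimir_vec l x : hasp false x ->
  iter l (@casimir I TW par posW kapW B) (vec x) = vec (iter l ad_casimir x).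
Proof. by move=> hx; elim: l => //= l ->; rewrite casimir_vec //; apply: hasp_iter. Qed.
End Ring.

Section Invariant.
Variables (B B' : pzRingType) (f : {rmorphism B -> B'}).
Hypothesis central : forall a b, f a * b = b * f a.
Hypothesis Btf : torsion_free B'.
Variables (g g' : I -> I -> B').
Hypotheses (gg : supercomm par g g) (gg' : supercomm par g g').
Hypotheses (g'g : supercomm par g' g) (g'g' : supercomm par g' g').
Hypothesis mulgV : forall a b, mulc g g' a b = (a == b)%:R.
Hypothesis mulVg : forall a b, mulc g' g a b = (a == b)%:R.
Variable delta : nat.
Hypothesis sdim : \sum_i sg (par i) (1 : int) = delta%:Z.
Hypothesis Ndelta : (N <= delta)%N.

Definition coef_mx : A -> A -> B' := kernel (grps par posM kapM g g' (enum 'I_N)).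

Lemma perm_enumW : perm_eq (enum {: TW}) (map inl (enum 'I_N) ++ map inr (enum 'I_N)).
Proof.
apply: uniq_perm; first exact: enum_uniq.
  have ue := enum_uniq 'I_N.
  rewrite cat_uniq (map_inj_uniq (f := inl)) ?(map_inj_uniq (f := inr)) ?ue; try by move=> ? ? [].
  by rewrite andbT; apply/hasPn => _ /mapP[t _ ->]; apply/mapP => -[s _].
move=> t; rewrite mem_enum mem_cat inE; apply/esym/orP.
by case: t => t; [left|right]; apply: map_f; rewrite mem_enum.
Qed.

(** Each slot of M occurs once with its own type and once flipped. Hence the induction starts with f
    = N pairs, however N splits into r and s. *)
Lemma size_kapW : (size (filter (predC kapW) (enum {: TW})) = N) * (size (filter kapW (enum {: TW})) = N).
Proof.
have cN : (count kapM (enum 'I_N) + count (predC kapM) (enum 'I_N) = N)%N.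
  by rewrite count_predC size_enum_ord.
split; rewrite size_filter (permP perm_enumW) count_cat (count_map inl) (count_map inr).
  rewrite -[RHS]cN; congr (_ + _)%N; apply: eq_count => t //=; exact: negbK.
by rewrite addnC -[RHS]cN.
Qed.

(** For the tensor of a supermatrix, invariance is invariance under conjugation by the generic
    matrix [coef_mx], which amounts to commuting with it. *)
Lemma nilp_commutes (x : A -> A -> B) j : hasp false x ->
  iter j (@casimir I TW par posW kapW B) (vec par kapM x) = 0 ->
  forall a b, mulk coef_mx (fun a b => f (x a b)) a b =
              mulk (fun a b => f (x a b)) coef_mx a b.
Proof.
move=> hx Cx; pose x' a b := f (x a b).
have vx : mapf f (vec par kapM x) = vec par kapM x'.
  by apply/ffunP => d; rewrite ffunE !vecE raddf_sg.
have hx' (h : I -> I -> B') : homk par h x'.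
  move=> i1 j1 a b; case: (eqVneq (tot a (+) tot b) false) => [->|/hx x0].
    by rewrite andbF /x' central.
  by rewrite /x' x0 rmorph0 mul0r mulr0 sg0.
have Cx' : iter j (@casimir I TW par posW kapW B') (vec par kapM x') = 0.
  rewrite -vx -[RHS](raddf0 (mapf (T:=TW) f)) -Cx.
  by elim: (j) => //= k ->; rewrite mapf_casimir.
have inv : grps par posW kapW g g' (enum {: TW}) (vec par kapM x') = vec par kapM x'.
  apply: (casimir_nilp_invariant (@posW_inj N) Btf gg gg' g'g g'g' mulgV sdim
    (p := filter (predC kapW) (enum {: TW})) (q := filter kapW (enum {: TW})) (ds := [::])
    _ _ _ _ Cx').
  - by rewrite !size_kapW.
  - by rewrite size_kapW addn0.
  - split=> //; [|exact: (filter_all (predC kapW))|exact: filter_all].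
    by rewrite /flat_pairs /= cats0 perm_catC; apply/permPl/perm_filterC.
  - by [].
have pe : perm_eq (enum {: TW}) (rev (map inl (rev (enum 'I_N))) ++ map inr (enum 'I_N)).
  by rewrite -map_rev revK perm_enumW.
move: inv; rewrite (grps_perm _ (@posW_inj N) gg gg' g'g g'g' _ (enum_uniq _) pe) grps_cat.
(* Undoing the action on the column slots alone moves the inverse matrix to the other side of the
   equation. *)
move/(congr1 (grps par posW kapW g' g (map inl (rev (enum 'I_N))))).
rewrite grpsK // vecL vecR // revK => /vec_inj E a b; rewrite -E.
rewrite (kernelE (F := grps par posM kapM g g' (enum 'I_N))) //; last exact: grps_scaler.
by apply: eq_bigr => c _; rewrite colkE.
Qed.
End Invariant.
End VecCasimir.

(** * Averaging *)

(** A subspace of maximal dimension contained in [J] must be all of [J]: adding the line of a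
    further vector of [J] would enlarge it. *)
Lemma subspace_vspace (k : fieldType) (V : vectType k) (J : V -> Prop) :
  J 0 -> (forall c u v, J u -> J v -> J (c *: u + v)) ->
  exists U : {vspace V}, forall v, v \in U <-> J v.
Proof.
move=> J0 JZ.
pose Q n := `[< exists U : {vspace V}, (forall v, v \in U -> J v) /\ \dim U = n >].
have exQ : exists n, Q n.
  exists 0%N; apply/asboolP; exists 0%VS; split; last exact: dimv0.
  by move=> v; rewrite memv0 => /eqP ->.
have bQ n : Q n -> (n <= \dim {:V})%N.
  by move=> /asboolP[U [_ <-]]; apply: dimvS; apply: subvf.
case: (ex_maxnP exQ bQ) => n /asboolP[U [UJ dU]] maxn.
exists U => v; split=> [|Jv]; first exact: UJ.
have JUv w : w \in (U + <[v]>)%VS -> J w.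
  case/memv_addP => u uU [_ /vlineP[c ->] ->]; rewrite addrC.
  by apply: JZ => //; apply: UJ.
have : Q (\dim (U + <[v]>)%VS) by apply/asboolP; exists (U + <[v]>)%VS.
move/maxn; rewrite -dU => le.
have /eqP -> : U == (U + <[v]>)%VS by rewrite eqEdim addvSl.
by apply: (subvP (addvSr _ _)); apply: memv_line.
Qed.

Lemma fitting_poly (k : fieldType) n (M : 'M[k]_n) :
  exists (j L : nat) (c : nat -> k), [/\ (0 < L)%N, c 0%N = 1 &
    forall u : 'rV_n, \sum_(l < L) c l *: iter (j + l) (mulmxr M) u = 0].
Proof.
case: n M => [|n] M.
  exists 0%N, 1%N, (fun=> 1); split=> // u.
  by apply/rowP => -[].
have [j [q]] := multiplicity_XsubC (char_poly M) 0.
have pn0 : char_poly M != 0 by rewrite monic_neq0 // char_poly_monic.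
rewrite pn0 /= /root subr0 => q0 Eq.
have q00 : q`_0 != 0 by rewrite -horner_coef0.
have qn0 : q != 0 by apply: contraNneq q00 => ->; rewrite coef0.
exists j, (size q), (fun l => q`_l / q`_0); split.
- by rewrite size_poly_gt0.
- by rewrite divff.
move=> u.
have powM l : iter l (mulmxr M) u = u *m M ^+ l.
  elim: l => [|l IH] /=; first by rewrite expr0 mulmx1.
  by rewrite IH exprSr mulmxA.
have : horner_mx M (char_poly M) = 0 by apply: Cayley_Hamilton.
rewrite Eq rmorphM rmorphXn /= horner_mx_X => qM.
transitivity ((q`_0)^-1 *: (u *m (horner_mx M q * M ^+ j))).
  have -> : horner_mx M q = \sum_(l < size q) q`_l *: M ^+ l.
    rewrite -{1}(coefK q) poly_def rmorph_sum; apply: eq_bigr => l _ /=.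
    by rewrite linearZ /= rmorphXn /= horner_mx_X.
  rewrite mulr_suml mulmx_sumr scaler_sumr; apply: eq_bigr => l _.
  by rewrite powM -scalerAl -scalemxAr scalerA [q`_l / _]mulrC -exprD addnC.
by rewrite qM mulmx0 scaler0.
Qed.

Lemma sg_mxE (V : zmodType) m n b (M : 'M[V]_(m, n)) i j : (sg b M) i j = sg b (M i j).
Proof. by case: b; rewrite /sg ?mxE. Qed.

Section Averaging.
Variables (k : fieldType) (S : algType k) (d : nat) (rho : {linear S -> 'M[k]_d}).
Hypothesis two : (2%:R : k) != 0.
Hypothesis rhoM : forall f g, rho (f * g) = rho f *m rho g.
Hypothesis rho_inj : injective rho.
Variables (s : 'I_d -> bool) (pi : S).
Hypothesis rho_pi : forall i j, rho pi i j = sg (s i) (i == j)%:R.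
Variable E : seq (S * S).
Hypothesis E1 : \sum_(e <- E) e.1 * e.2 = 1.
Hypothesis Ecomm : forall x : 'M[k]_d, (forall i j, s i != s j -> x i j = 0) ->
  forall f, rho f *m (\sum_(e <- E) rho e.1 *m x *m rho e.2) =
            (\sum_(e <- E) rho e.1 *m x *m rho e.2) *m rho f.

Lemma averaging_semisimple : semisimple S.
Proof.
move=> J [J0 JD JM].
have [U UP] : exists U : {vspace 'M[k]_d}, forall v, v \in U <-> exists2 f, J f & rho f = v.
  apply: subspace_vspace; first by exists 0; rewrite ?linear0.
  move=> c _ _ [f Jf <-] [g Jg <-]; exists (c *: f + g); last by rewrite linearP.
  by apply: JD => //; rewrite -[f]mul1r scalerAl; apply: JM.
pose P0 (z : 'M[k]_d) := projv U z.
(* The average of an arbitrary projection over the group formed by 1 and the parity operator. It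
   commutes with [pi], so its blocks are even, the case covered by [Ecomm]. *)
pose P z := 2%:R^-1 *: (P0 z + rho pi *m P0 (rho pi *m z)).
have pi2 z : rho pi *m (rho pi *m z) = z.
  apply/matrixP => i j; rewrite mxE (bigD1 i) //= big1 ?addr0 => [|l /negPf li]; last first.
    by rewrite rho_pi eq_sym li sg0 mul0r.
  rewrite mxE (bigD1 i) //= big1 ?addr0 => [|l /negPf li]; last first.
    by rewrite rho_pi eq_sym li sg0 mul0r.
  by rewrite !rho_pi eqxx !sgMl !mul1r sg_sg addbb.
have UM f z : z \in U -> rho f *m z \in U.
  by move=> /UP[g Jg <-]; apply/UP; exists (f * g); [apply: JM | rewrite rhoM].
have PU z : P z \in U.
  by rewrite memvZ // memvD ?memv_proj // UM // memv_proj.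
have P_id z : z \in U -> P z = z.
  move=> zU; rewrite /P /P0 !projv_id ?UM // pi2 -mulr2n -scaler_nat scalerA mulVf //.
  by rewrite scale1r.
have PD c z z' : P (c *: z + z') = c *: P z + P z'.
  have PE y : P y = 2%:R^-1 *: (projv U y + rho pi *m projv U (rho pi *m y)) by [].
  rewrite !PE [rho pi *m (_ + z')]mulmxDr -scalemxAr !(linearP (projv U)) mulmxDr -scalemxAr.
  by rewrite addrACA -(scalerDr c) [LHS]scalerDr !scalerA [c * _]mulrC.
have Ppi z : P (rho pi *m z) = rho pi *m P z.
  by rewrite /P pi2 -scalemxAr mulmxDr pi2 addrC.
have PL : linear P := PD.
pose Pl : {linear 'M[k]_d -> 'M[k]_d} := HB.pack P (GRing.isLinear.Build k _ _ _ P PL).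
(* A matrix is a list of d columns, each in M, and [rho f] acts on every column separately.
   [blk u v] is the component of [P] from column [v] to column [u], an endomorphism of M to which
   [Ecomm] applies. *)
pose blk u v : 'M[k]_d := \matrix_(i, j) P (delta_mx j v) i u.
have Pblk z i u : P z i u = \sum_v (blk u v *m z) i v.
  rewrite {1}(matrix_sum_delta z) exchange_big -[P _]/(Pl _) linear_sum summxE.
  apply: eq_bigr => v _; rewrite linear_sum summxE mxE; apply: eq_bigr => j _.
  by rewrite linearZ /= !mxE mulrC.
have blk_even u v i j : s i != s j -> blk u v i j = 0.
  move=> sij; rewrite mxE.
  have := congr1 (fun A : 'M_d => A i u) (Ppi (delta_mx j v)).
  have -> : rho pi *m delta_mx j v = sg (s j) (delta_mx j v).
    apply/matrixP => a b; rewrite mxE (bigD1 a) //= big1 ?addr0 => [|l /negPf li]; last first.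
      by rewrite rho_pi eq_sym li sg0 mul0r.
    rewrite rho_pi eqxx sgMl mul1r.
    rewrite sg_mxE.
    by case: (a =P j) => [->//|/eqP/negPf aj]; rewrite mxE aj !sg0.
  rewrite [P (sg _ _)](raddf_sg Pl) /= [in RHS]mxE (bigD1 i) //= big1 ?addr0; last first.
    by move=> l /negPf li; rewrite rho_pi eq_sym li sg0 mul0r.
  rewrite rho_pi eqxx sgMl mul1r sg_mxE; move: (P (delta_mx j v) i u) => x.
  have neg0 : x = - x -> x = 0.
    move=> /eqP; rewrite -addr_eq0 -mulr2n -mulr_natl mulf_eq0 (negPf two) => /eqP.
    by [].
  by move: sij; case: (s i); case: (s j) => //= _ h; apply: neg0; first [exact: h | exact: esym h].
pose Q z := \sum_(e <- E) rho e.1 *m P (rho e.2 *m z).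
have QU z : Q z \in U by apply: rpred_sum => e _; apply: UM.
have Q_id z : z \in U -> Q z = z.
  move=> zU; rewrite /Q; have [f Jf <-] := (UP z).1 zU.
  transitivity (rho ((\sum_(e <- E) e.1 * e.2) * f)); last by rewrite E1 mul1r.
  rewrite mulr_suml linear_sum; apply: eq_bigr => e _.
  by rewrite P_id ?UM //; [rewrite -!rhoM mulrA | apply/UP; exists f].
have QB z z' : Q (z - z') = Q z - Q z'.
  rewrite /Q -sumrB; apply: eq_bigr => e _.
  by rewrite mulmxBr -[P _]/(Pl _) linearB /= mulmxBr.
have QD z z' : Q (z + z') = Q z + Q z'.
  by rewrite -{1}[z']opprK QB -[- z']sub0r QB -{1}(subrr z) QB subrr sub0r opprK.
have Qcomm f z : Q (rho f *m z) = rho f *m Q z.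
  have Qblk y i u : Q y i u = \sum_v ((\sum_(e <- E) rho e.1 *m blk u v *m rho e.2) *m y) i v.
    rewrite /Q summxE; under [RHS]eq_bigr => v _ do rewrite mulmx_suml summxE.
    rewrite [RHS]exchange_big; apply: eq_bigr => e _ /=.
    rewrite [LHS]mxE; under [LHS]eq_bigr => a _ do rewrite Pblk mulr_sumr.
    rewrite exchange_big; apply: eq_bigr => v _; rewrite -!mulmxA.
    by rewrite [RHS]mxE.
  apply/matrixP => i u; rewrite Qblk mxE.
  under [RHS]eq_bigr => a _ do rewrite Qblk mulr_sumr.
  rewrite exchange_big; apply: eq_bigr => v _ /=.
  by rewrite mulmxA -Ecomm => [|a b]; [rewrite -mulmxA mxE | apply: blk_even].
(* [Q] is a projection onto the image of [J] that commutes with left multiplication by S, so its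
   kernel gives the complement. *)
exists (fun f => Q (rho f) = 0); split.
- split=> [|a b Qa Qb|c a Qa].
  + by rewrite linear0 -{1}(subrr (0 : 'M[k]_d)) QB subrr.
  + by rewrite linearD QD Qa Qb addr0.
  + by rewrite rhoM Qcomm Qa mulmx0.
- move=> a; have [b Jb Eb] := (UP _).1 (QU (rho a)).
  exists b, (a - b); split=> //; last by rewrite addrC subrK.
  by rewrite linearB /= QB Eb (Q_id _ (QU _)) subrr.
- move=> a Ja Qa; apply: rho_inj; rewrite linear0 -Qa Q_id //.
  by apply/UP; exists a.
Qed.
End Averaging.

(** * The averaging element as a polynomial in the Casimir operator *)

Section Representation.
Variables (k : fieldType) (I : finType) (par : I -> bool) (N : nat) (kapM : 'I_N -> bool).
Notation A := {ffun 'I_N -> I}.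
Notation TW := ('I_N + 'I_N)%type.
Notation posW := (@posW N).
Notation kapW := (kapW kapM).
Notation tot := (tot par).
Notation casimirW := (@casimir I TW par posW kapW k).
Notation p i j := (par i (+) par j).
Implicit Types (x z : A -> A -> k).
Hypothesis two : (2%:R : k) != 0.
Variables (S : algType k) (R : S -> A -> A -> k).
Hypothesis RL : forall c f g a b, R (c *: f + g) a b = c * R f a b + R g a b.
Hypothesis RM : forall f g a b, R (f * g) a b = mulk (R f) (R g) a b.
Hypothesis Rinj : forall f g, (forall a b, R f a b = R g a b) -> f = g.
Variable Y : I -> I -> S.
Hypothesis RY : forall i j a b, R (Y i j) a b = gl_kernel par kapM k i j a b.
Variable pi : S.
Hypothesis Rpi : forall a b, R pi a b = sg (tot a) (a == b)%:R.
Hypothesis Rcomm : forall j z, hasp par false z ->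
  iter j casimirW (vec par kapM z) = 0 ->
  forall f a b, mulk (R f) z a b = mulk z (R f) a b.

Lemma R0 a b : R 0 a b = 0.
Proof. by have := RL (-1) 0 0 a b; rewrite scaler0 addr0 mulN1r addNr. Qed.

Lemma RD f g a b : R (f + g) a b = R f a b + R g a b.
Proof. by have := RL 1 f g a b; rewrite scale1r mul1r. Qed.

Lemma RZ c f a b : R (c *: f) a b = c * R f a b.
Proof. by have := RL c f 0 a b; rewrite addr0 R0 addr0. Qed.

Lemma R1 a b : R 1 a b = (a == b)%:R.
Proof.
(* The square of [R pi] is the identity, so R 1 = R 1 R (pi pi) = R (pi pi) is the identity as
   well. *)
have Rpi2 a' b' : R (pi * pi) a' b' = (a' == b')%:R.
  rewrite RM /mulk (bigD1 a') //= big1 ?addr0 => [|c /negPf ca]; last first.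
    by rewrite Rpi eq_sym ca sg0 mul0r.
  by rewrite !Rpi eqxx sgMl mul1r sg_sg addbb.
rewrite -[LHS](mulk1 (R 1)) -Rpi2 -[pi * pi]mul1r RM; apply: eq_mulk => // a' b'.
by rewrite Rpi2 /kernel ffunE.
Qed.

(* The list [E] of pairs (u, v) stands for the sum of the tensors u (x) v in
   S (x) S^op, and [w] is its image under multiplication. *)
Definition bimod (F : (A -> A -> k) -> A -> A -> k) (w : S) :=
  exists E : seq (S * S), (\sum_(e <- E) e.1 * e.2 = w) /\
    forall x a b, F x a b = \sum_(e <- E) mulk (mulk (R e.1) x) (R e.2) a b.

Lemma bimod_id : bimod id 1.
Proof.
exists [:: (1, 1)]; split=> [|x a b]; rewrite big_seq1 ?mulr1 //=.
rewrite /mulk (bigD1 b) //= [X in _ + X]big1 ?addr0 => [|c /negPf cb]; last by rewrite R1 cb mulr0.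
rewrite R1 eqxx mulr1 (bigD1 a) //= big1 ?addr0 => [|c /negPf ca].
  by rewrite R1 eqxx mul1r.
by rewrite R1 eq_sym ca mul0r.
Qed.

Lemma bimodL f F w : bimod F w -> bimod (fun x => mulk (R f) (F x)) (f * w).
Proof.
case=> E [<- EF]; exists [seq (f * e.1, e.2) | e <- E]; split=> [|x a b].
  by rewrite big_map mulr_sumr; apply: eq_bigr => e _; rewrite mulrA.
rewrite big_map /=.
transitivity (\sum_(e <- E) mulk (R f) (mulk (mulk (R e.1) x) (R e.2)) a b).
  rewrite /mulk [RHS]exchange_big; apply: eq_bigr => c _; rewrite EF mulr_sumr.
  by [].
apply: eq_bigr => e _; rewrite mulkA; apply: eq_mulk => // {}a {}b.
by rewrite mulkA; apply: eq_mulk => // {}a {}b; rewrite RM.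
Qed.

Lemma bimodR f F w : bimod F w -> bimod (fun x => mulk (F x) (R f)) (w * f).
Proof.
case=> E [<- EF]; exists [seq (e.1, e.2 * f) | e <- E]; split=> [|x a b].
  by rewrite big_map mulr_suml; apply: eq_bigr => e _; rewrite mulrA.
rewrite big_map /=.
transitivity (\sum_(e <- E) mulk (mulk (mulk (R e.1) x) (R e.2)) (R f) a b).
  rewrite /mulk [RHS]exchange_big; apply: eq_bigr => c _; rewrite EF mulr_suml.
  by [].
by apply: eq_bigr => e _; rewrite -mulkA; apply: eq_mulk.
Qed.

Lemma bimodZ c F w : bimod F w -> bimod (fun x a b => c * F x a b) (c *: w).
Proof.
case=> E [<- EF]; exists [seq (c *: e.1, e.2) | e <- E]; split=> [|x a b].
  by rewrite big_map scaler_sumr; apply: eq_bigr => e _; rewrite scalerAl.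
rewrite big_map EF mulr_sumr; apply: eq_bigr => e _; rewrite /mulk mulr_sumr /=.
apply: eq_bigr => d _; rewrite mulrA; congr (_ * _); rewrite mulr_sumr.
by apply: eq_bigr => d' _; rewrite RZ mulrA.
Qed.

Lemma bimodD F w F' w' : bimod F w -> bimod F' w' ->
  bimod (fun x a b => F x a b + F' x a b) (w + w').
Proof.
case=> E [<- EF] [E' [<- EF']]; exists (E ++ E'); split=> [|x a b].
  by rewrite big_cat.
by rewrite big_cat EF EF'.
Qed.

Lemma bimod_sg s F w : bimod F w -> bimod (fun x a b => sg s (F x a b)) (sg s w).
Proof.
case: s => //= /(bimodZ (-1)) [E [E1 E2]]; exists E; split; first by rewrite E1 scaleN1r.
by move=> x a b; rewrite -E2 mulN1r.
Qed.

Lemma bimod_sum (J : Type) (l : seq J) (F : J -> (A -> A -> k) -> A -> A -> k) w :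
  (forall i, bimod (F i) (w i)) ->
  bimod (fun x a b => \sum_(i <- l) F i x a b) (\sum_(i <- l) w i).
Proof.
move=> Fw; elim: l => [|i l [E [E1 E2]]].
  by exists [::]; split=> [|x a b]; rewrite !big_nil.
have [E' [E1' E2']] := Fw i; exists (E' ++ E); split=> [|x a b].
  by rewrite big_cat big_cons E1 E1'.
by rewrite big_cat big_cons E2 E2'.
Qed.

Lemma eq_bimod F F' w : (forall x a b, F x a b = F' x a b) -> bimod F w -> bimod F' w.
Proof. by move=> FF [E [E1 E2]]; exists E; split=> // x a b; rewrite -FF. Qed.

Lemma bimod_gl_bracket th i j F w : bimod F w ->
  bimod (fun x => gl_bracket par kapM th i j (F x)) (Y i j * w - sg (p i j && th) (w * Y i j)).
Proof.
move=> Fw.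
have := bimodD (bimodL (Y i j) Fw) (bimod_sg true (bimod_sg (p i j && th) (bimodR (Y i j) Fw))).
apply: eq_bimod => x a b; rewrite /gl_bracket /sg; congr (_ - _).
  by apply: eq_mulk => // {}a {}b; apply: RY.
by case: (_ && _) => /=; first congr (- _); apply: eq_mulk => // {}a {}b; apply: RY.
Qed.

(** Under multiplication a bracket with [Y j i] becomes a commutator with the image obtained so far.
    That image is 1 or 0, and the inner bracket carries no sign, so it vanishes as soon as C occurs
    once. *)
Lemma bimod_iter l : bimod (fun x => iter l (@ad_casimir I par N kapM k) x) (l == 0)%:R.
Proof.
elim: l => [|l IH]; first exact: bimod_id.
have := bimod_sum (index_enum I) (fun i => bimod_sum (index_enum I) (fun j =>
  bimod_sg (par j) (bimod_gl_bracket (p i j) i j (bimod_gl_bracket false j i IH)))).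
set w := \sum_(i <- _) _; suff -> : w = 0 by [].
rewrite /w big1 // => i _; rewrite big1 // => j _.
rewrite andbF andbb /=; case: l {IH w} => [|l] /=.
  by rewrite !mulr1 !mul1r subrr mulr0 mul0r sg0 subrr sg0.
by rewrite !(mulr0, mul0r) subrr mulr0 mul0r sg0 subrr sg0.
Qed.

Lemma casimir_scaler (w : {ffun {ffun TW -> I} -> k}) r :
  casimirW (scaler w r) = scaler (casimirW w) r.
Proof.
apply/ffunP => d; rewrite /casimir sum_ffunE ffunE sum_ffunE mulr_suml.
apply: eq_bigr => i _; rewrite !sum_ffunE mulr_suml; apply: eq_bigr => j _.
by rewrite !gl_sum_scaler !sg_ffunE ffunE sgMl.
Qed.

Lemma casimir_poly : exists (j L : nat) (c : nat -> k), [/\ (0 < L)%N, c 0%N = 1 &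
  forall w : {ffun {ffun TW -> I} -> k},
    \sum_(l < L) scaler (iter (j + l) casimirW w) (c l) = 0].
Proof.
pose D := {ffun TW -> I}.
pose M : 'M[k]_#|D| := \matrix_(i, j) kernel casimirW (enum_val j) (enum_val i).
have [j [L [c [L0 c0 cM]]]] := fitting_poly M; exists j, L, c; split=> // w.
pose row (v : {ffun D -> k}) : 'rV_#|D| := \row_i v (enum_val i).
have rowC v : row (casimirW v) = row v *m M.
  apply/rowP => i; rewrite !mxE.
  rewrite (kernelE (F := casimirW)); last exact: casimir_scaler.
  rewrite (reindex (enum_val (A := {: D}))) /=; last exact/onW_bij/enum_val_bij.
  by apply: eq_bigr => a _; rewrite !mxE mulrC.
have rowI l v : row (iter l casimirW v) = iter l (mulmxr M) (row v).
  by elim: l => //= l <-; rewrite rowC.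
apply/ffunP => d; rewrite sum_ffunE ffunE.
have := congr1 (fun u : 'rV_#|D| => u 0 (enum_rank d)) (cM (row w)).
rewrite summxE mxE => E; rewrite -[RHS]E; apply: eq_bigr => l _.
by rewrite -rowI !mxE enum_rankK ffunE mulrC.
Qed.

Theorem semisimple_of_rep : semisimple S.
Proof.
have [j [L [c [L0 c0 cC]]]] := casimir_poly.
(* This is q(C); its image under multiplication is [c 0], that is 1. *)
have : bimod (fun x a b => \sum_(l <- index_enum 'I_L) c l * iter l (@ad_casimir I par N kapM k) x a b) 1.
  have := bimod_sum (index_enum 'I_L) (fun l : 'I_L => bimodZ (c l) (bimod_iter l)).
  set w := \sum_(l <- _) _; suff -> : w = 1 by [].
  case: (L) L0 @w => // L' _; rewrite big_ord_recl c0 scale1r /= big1 ?addr0 //.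
  by move=> l _; rewrite scaler0.
move=> [E [E1 EF]].
pose tom (x : A -> A -> k) : 'M[k]_#|A| := \matrix_(i, j) x (enum_val i) (enum_val j).
pose ofm (M : 'M[k]_#|A|) (a b : A) := M (enum_rank a) (enum_rank b).
have ofmK M : tom (ofm M) = M by apply/matrixP => i i'; rewrite mxE /ofm !enum_valK.
have tomM x z : tom (mulk x z) = tom x *m tom z.
  apply/matrixP => i i'; rewrite !mxE /mulk (reindex (enum_val (A := {: A}))) /=.
    by apply: eq_bigr => l _; rewrite !mxE.
  exact/onW_bij/enum_val_bij.
have tom_eq x z : (forall a b, x a b = z a b) -> tom x = tom z.
  by move=> xz; apply/matrixP => i i'; rewrite !mxE xz.
pose rho f := tom (R f).
have rhoL : linear rho.
  by move=> a f g; apply/matrixP => i i'; rewrite !mxE RL.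
pose rhol : {linear S -> 'M[k]_#|A|} := HB.pack rho (GRing.isLinear.Build k _ _ _ rho rhoL).
apply: (@averaging_semisimple k S #|A| rhol two _ _ (fun i => tot (enum_val i)) pi _ E E1).
- by move=> f g; rewrite /= /rho -tomM; apply: tom_eq => a b; apply: RM.
- move=> f g /= fg; apply: Rinj => a b.
  have := congr1 (fun M : 'M_#|A| => M (enum_rank a) (enum_rank b)) fg.
  by rewrite !mxE !enum_rankK.
- by move=> i i'; rewrite /= mxE Rpi (inj_eq enum_val_inj).
move=> M Mev f /=; pose x := ofm M.
have hx : hasp par false x.
  by move=> a b; rewrite addbC => ab; apply: Mev; rewrite !enum_rankK; move: ab; case: tot; case: tot.
pose z a b := \sum_(l < L) c l * iter l (@ad_casimir I par N kapM k) x a b.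
have -> : \sum_(e <- E) rho e.1 *m M *m rho e.2 = tom z.
  apply/matrixP => i i'; rewrite mxE /z EF summxE; apply: eq_bigr => e _.
  by rewrite /rho -{1}(ofmK M) -!tomM mxE.
rewrite /rho -!tomM; apply: tom_eq => a b; apply: (Rcomm (j := j)).
  move=> {}a {}b ab; rewrite /z big1 // => l _.
  by rewrite (@hasp_iter _ _ _ _ _ l _ hx _ _ ab) mulr0.
(* The tensor of q(C) x is q(C) applied to the tensor of x, so a further C^j kills it by the
   relation [cC]. *)
have -> : vec par kapM z = \sum_(l < L) scaler (iter l casimirW (vec par kapM x)) (c l).
  apply/ffunP => d; rewrite vecE sum_ffunE /z sg_sum; apply: eq_bigr => l _.
  by rewrite ffunE iter_casimir_vec // vecE sgMl mulrC.
have -> l (w : 'I_L -> {ffun {ffun TW -> I} -> k}) :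
    iter l casimirW (\sum_i w i) = \sum_i iter l casimirW (w i).
  by elim: l => //= l ->; rewrite raddf_sum.
rewrite -[RHS](cC (vec par kapM x)); apply: eq_bigr => l _.
rewrite iterD; elim: (j) => //= n ->; exact: casimir_scaler.
Qed.
End Representation.

(** * Superalgebras and points over the dual numbers *)

Lemma sg_signr (R : pzRingType) (b : bool) (x : R) : (-1) ^+ b * x = sg b x.
Proof. by case: b; rewrite /sg ?mulN1r ?mul1r. Qed.

Section SuperAlgebraTheory.
Variables (k : fieldType) (A : superAlgebra k).
Implicit Types (a b : A) (q : bool).

HB.instance Definition _ q := GRing.isLinear.Build k A A _ (@part k A q) (@part_linear k A q).

Lemma homog_part q a : homog q (part q a).
Proof. by rewrite /homog part_part eqxx. Qed.

Lemma part_homog q q' a : homog q a -> part q' a = if q' == q then a else 0.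
Proof. by move=> ha; rewrite -ha part_part. Qed.

Lemma homogM q q' a b : homog q a -> homog q' b -> homog (q (+) q') (a * b).
Proof. exact: part_mul. Qed.

Lemma homog1 : homog false (1 : A). Proof. exact: part_one. Qed.

Lemma homog_sum (J : Type) (l : seq J) q (F : J -> A) :
  (forall j, homog q (F j)) -> homog q (\sum_(j <- l) F j).
Proof. by move=> hF; rewrite /homog raddf_sum; apply: eq_bigr => j _; apply: hF. Qed.

Lemma homog_sg q s a : homog q a -> homog q (sg s a).
Proof. by move=> ha; rewrite /homog raddf_sg /= ha. Qed.

Lemma part_mulr q q' a b : homog q a -> part q' (a * b) = a * part (q' (+) q) b.
Proof.
move=> ha; rewrite -{1}(part_sum b) mulrDr raddfD /=.
rewrite !(part_homog _ (homogM ha (homog_part _ _))) addbF addbT.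
by case: q ha => ha; case: q'; rewrite /= ?addr0 ?add0r.
Qed.

(** Taking from each entry of [Y] the part of the expected parity gives again a right inverse of
    [X], which equals [Y] by uniqueness of inverses. *)
Lemma homog_inverse (I : finType) (par : I -> bool) (X Y : I -> I -> A) :
  (forall i j, homog (par i (+) par j) (X i j)) ->
  (forall i j, mulc X Y i j = (i == j)%:R) -> (forall i j, mulc Y X i j = (i == j)%:R) ->
  forall i j, homog (par i (+) par j) (Y i j).
Proof.
move=> hX XY YX i j; pose Z i j := part (par i (+) par j) (Y i j).
have XZ (a b : I) : mulc X Z a b = (a == b)%:R.
  rewrite -[LHS]/(\sum_l _); transitivity (part (par a (+) par b) (mulc X Y a b)).
    rewrite /mulc raddf_sum; apply: eq_bigr => l _; rewrite /= (part_mulr _ _ (hX a l)) /Z.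
    by congr (_ * part _ _); case: (par a); case: (par b); case: (par l).
  rewrite XY; case: eqP => [->|_]; last by rewrite raddf0.
  by rewrite addbb; exact: part_one.
rewrite /homog -/(Z i j).
transitivity (\sum_l mulc Y X i l * Z l j).
  rewrite (bigD1 i) //= YX eqxx mul1r big1 ?addr0 // => l /negPf li.
  by rewrite YX eq_sym li mul0r.
transitivity (\sum_l Y i l * mulc X Z l j).
  rewrite /mulc; under eq_bigr => l _ do rewrite mulr_suml.
  rewrite exchange_big; apply: eq_bigr => l _; rewrite mulr_sumr.
  by apply: eq_bigr => a _; rewrite mulrA.
rewrite (bigD1 j) //= XZ eqxx mulr1 big1 ?addr0 // => l /negPf lj.
by rewrite XZ lj mulr0.
Qed.

Lemma supercomm_homog (I : finType) (par : I -> bool) (X Y : I -> I -> A) :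
  supercommutative A ->
  (forall i j, homog (par i (+) par j) (X i j)) ->
  (forall i j, homog (par i (+) par j) (Y i j)) -> supercomm par X Y.
Proof. by move=> sc hX hY i j i' j'; rewrite (sc _ _ _ _ (hX i j) (hY i' j')) sg_signr. Qed.

End SuperAlgebraTheory.

Section DualNumbers.
Variable k : fieldType.

Definition dual_numbers : Type := (k * k)%type.
HB.instance Definition _ := GRing.Lmodule.copy dual_numbers (k^o * k^o)%type.
Implicit Types (u v w : dual_numbers).

Definition dual_mul u v : dual_numbers := (u.1 * v.1, u.1 * v.2 + u.2 * v.1).

Lemma dual_eq u v : u.1 = v.1 -> u.2 = v.2 -> u = v.
Proof. by case: u v => [? ?] [? ?] /= -> ->. Qed.

Lemma dual_addE u v : ((u + v).1 = u.1 + v.1) * ((u + v).2 = u.2 + v.2).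
Proof. by []. Qed.
Lemma dual_scaleE c u : ((c *: u).1 = c * u.1) * ((c *: u).2 = c * u.2).
Proof. by []. Qed.

Lemma dual_mulA : associative dual_mul.
Proof. by move=> u v w; apply: dual_eq => /=; ring. Qed.
Lemma dual_mulC : commutative dual_mul.
Proof. by move=> u v; apply: dual_eq => /=; ring. Qed.
Lemma dual_mul1 : left_id ((1, 0) : dual_numbers) dual_mul.
Proof. by move=> u; apply: dual_eq => /=; ring. Qed.
Lemma dual_mulDl : left_distributive dual_mul +%R.
Proof. by move=> u v w; apply: dual_eq; rewrite /dual_mul ?dual_addE /= ?dual_addE; ring. Qed.
Lemma dual_1neq0 : ((1, 0) : dual_numbers) != 0.
Proof. by apply/eqP => -[] /eqP; rewrite oner_eq0. Qed.

HB.instance Definition _ := GRing.Zmodule_isComNzRing.Build dual_numbers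
  dual_mulA dual_mulC dual_mul1 dual_mulDl dual_1neq0.

Lemma dual_scaleAl c u v : c *: (u * v) = (c *: u) * v.
Proof. by apply: dual_eq => /=; rewrite /GRing.scale /=; ring. Qed.

HB.instance Definition _ := GRing.Lmodule_isLalgebra.Build k dual_numbers dual_scaleAl.
HB.instance Definition _ := GRing.Lalgebra_isComAlgebra.Build k dual_numbers.

Variable tau : bool.

(** [tau] is the parity of the infinitesimal, so odd elementary matrices are reached by points as
    well as even ones; supercommutativity survives because the infinitesimal squares to zero. *)
Definition dual_part q u : dual_numbers :=
  (if q then 0 else u.1, if q == tau then u.2 else 0).

Definition dual_super : superAlgebra k.
Proof.
refine (@SuperAlgebra k dual_numbers dual_part _ _ _ _ _).
- move=> q c u v; apply: dual_eq; rewrite ?dual_addE ?dual_scaleE /dual_part /= ?dual_addE ?dual_scaleE;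
    case: q; case: tau; rewrite /= ?dual_addE ?dual_scaleE /= ?scaler0 ?addr0 ?mulr0 //.
- move=> u; apply: dual_eq; rewrite dual_addE /dual_part /=; case: tau; rewrite /=; ring.
- by move=> q q' u; apply: dual_eq; rewrite /dual_part; case: q; case: q'; case: tau.
- by apply: dual_eq; rewrite /dual_part; case: tau.
- by move=> q q' u v <- <-; apply: dual_eq; rewrite /dual_part; case: q; case: q'; case: tau; rewrite /=; ring.
Defined.

Lemma dual_supercommutative : supercommutative dual_super.
Proof.
move=> q q' u v <- <-; rewrite sg_signr; apply: dual_eq;
 case: q; case: q'; case: tau; rewrite /sg /=; ring.
Qed.

Lemma dual_invertible u : u.1 != 0 -> invertible u.
Proof.
move=> u0; exists ((u.1^-1, - u.2 / u.1 ^+ 2) : dual_numbers).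
by split; apply: dual_eq => /=; field.
Qed.

End DualNumbers.

Section Points.
Variables (k : fieldType) (m n : nat) (A : superAlgebra k) (X : 'M[A]_(m + n)).
Hypothesis XP : is_coordinate_GL X.

Lemma coordinate_supercommutative : supercommutative A.
Proof. by case: XP => P [x [iota [_ [? _ _ _] _]]]. Qed.

Lemma coordinate_homog i j : homog (ipar i (+) ipar j) (X i j).
Proof.
case: XP => P [x [iota [[_ hx _] [_ ev _ _] ->]]]; rewrite /homog !mxE -ev.
by congr (iota _); apply: (hx (i, j)).
Qed.

Lemma rmorph_det (R R' : pzRingType) (f : {rmorphism R -> R'}) d (M : 'M[R]_d) :
  f (\det M) = \det (map_mx f M).
Proof.
rewrite rmorph_sum; apply: eq_bigr => s _.
by rewrite rmorphM rmorph_sign rmorph_prod; congr (_ * _); apply: eq_bigr => i _; rewrite mxE.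
Qed.

(** Modulo the infinitesimal the point is diagonal with nonzero entries [c i], so both block
    determinants are invertible there, hence invertible: this is what the localization requires. *)
Lemma point_exists tau (h : 'I_(m + n) -> 'I_(m + n) -> dual_super k tau)
    (c : 'I_(m + n) -> k) :
  (forall i j, homog (ipar i (+) ipar j) (h i j)) ->
  (forall i, c i != 0) -> (forall i j, (h i j).1 = c i * (i == j)%:R) ->
  exists phi : {lrmorphism A -> dual_super k tau}, forall i j, phi (X i j) = h i j.
Proof.
move=> hh c0 hc; case: XP => P [x [iota [[_ _ free] [_ _ _ loc] ->]]].
have [[f [fe fx]] _] := free (dual_super k tau) (fun ij => h ij.1 ij.2)
  (dual_supercommutative (tau := tau)) (fun ij => hh ij.1 ij.2).
have fst_zmod : zmod_morphism (fun a : P => (f a).1 : k) by move=> a b /=; rewrite rmorphB.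
have fst_mon : monoid_morphism (fun a : P => (f a).1 : k).
  by split=> [|a b] /=; rewrite ?rmorph1 // rmorphM.
pose psi : {rmorphism P -> k} := HB.pack (fun a : P => (f a).1 : k)
  (GRing.isZmodMorphism.Build _ _ _ fst_zmod) (GRing.isMonoidMorphism.Build _ _ _ fst_mon).
have fd : invertible (f (\det (ulsubmx (\matrix_(i, j) x (i, j))) *
                        \det (drsubmx (\matrix_(i, j) x (i, j))))).
  apply: dual_invertible; rewrite -[_.1]/(psi _) rmorphM !rmorph_det.
  have -> : map_mx psi (ulsubmx (\matrix_(i, j) x (i, j))) = diag_mx (\row_i c (lshift n i)).
    apply/matrixP => i j; rewrite !mxE /= fx hc /= (inj_eq (@lshift_inj _ _)).
    by rewrite mulr_natr.
  have -> : map_mx psi (drsubmx (\matrix_(i, j) x (i, j))) = diag_mx (\row_i c (rshift m i)).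
    apply/matrixP => i j; rewrite !mxE /= fx hc /= (inj_eq (@rshift_inj _ _)).
    by rewrite mulr_natr.
  rewrite !det_diag mulf_neq0 //; apply/prodf_neq0 => i _; by rewrite mxE.
have [[phi [_ phiE]] _] := loc _ f (dual_supercommutative (tau := tau)) fe fd.
by exists phi => i j; rewrite !mxE phiE fx.
Qed.
End Points.

(** * Matrix entries of the group action and its differential *)

Section Entries.
Variables (I T : finType) (par : I -> bool) (pos : T -> nat) (kap : T -> bool).
Notation A := {ffun T -> I}.
Implicit Types (a b d : A) (l : seq T).

Section Ring.
Variables (B : pzRingType) (g g' : I -> I -> B).
Notation grps := (grps par pos kap g g').

Lemma kernel_grps_cons t l a b : kernel (grps (t :: l)) a b = \sum_i
  sg (slot_sign par pos kap t a i) (slot_coef g g' (kap t) (a t) i * kernel (grps l) (upd a t i) b).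
Proof. by rewrite /kernel /= /grp slotopE. Qed.

Lemma kernel_grps0 l a b t : t \notin l -> a t != b t -> kernel (grps l) a b = 0.
Proof.
elim: l a => [|u l IH] a.
  by move=> _ ab; rewrite /kernel ffunE; case: eqP => // E; rewrite E eqxx in ab.
rewrite inE negb_or => /andP[tu tl] ab; rewrite kernel_grps_cons big1 // => i _.
by rewrite IH ?mulr0 ?sg0 // upd_other.
Qed.

Lemma kernel_grps l a b : uniq l -> (forall t, t \notin l -> a t = b t) ->
  exists s, kernel (grps l) a b =
    sg s (\prod_(t <- l) slot_coef g g' (kap t) (a t) (b t)).
Proof.
elim: l a => [|t l IH] a.
  move=> _ ab; exists false; rewrite big_nil /kernel ffunE.
  by rewrite (_ : a = b) ?eqxx //; apply/ffunP => t; apply: ab.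
move=> /= /andP[tl ul] ab; have [||s Es] := IH (upd a t (b t)); first by [].
  move=> x xl; case: (eqVneq x t) => [->|xt]; first by rewrite upd_same.
  by rewrite upd_other // ab // inE negb_or xt.
exists (slot_sign par pos kap t a (b t) (+) s); rewrite kernel_grps_cons.
rewrite (bigD1 (b t)) //= big1 ?addr0 => [|i ib]; last first.
  by rewrite (kernel_grps0 tl) ?mulr0 ?sg0 // upd_same.
rewrite Es big_cons sgMr sg_sg; congr (sg _ (_ * _)).
rewrite big_seq [RHS]big_seq; apply: eq_bigr => x xl; rewrite upd_other //.
by apply: contraNneq tl => <-.
Qed.

End Ring.

Lemma grps_homog (k : fieldType) (B : superAlgebra k) (g g' : I -> I -> B) l (be : bool)
    (w : {ffun A -> B}) (tot := fun d : A => \big[addb/false]_t par (d t)) :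
  (forall i j, homog (par i (+) par j) (g i j)) ->
  (forall i j, homog (par i (+) par j) (g' i j)) ->
  (forall d, homog (tot d (+) be) (w d)) ->
  forall d, homog (tot d (+) be) (grps par pos kap g g' l w d).
Proof.
move=> hg hg' hw; elim: l => //= t l IH d; rewrite /grp slotopE; apply: homog_sum => i.
apply: homog_sg.
have -> : tot d (+) be = (par (d t) (+) par i) (+) (tot (upd d t i) (+) be).
  rewrite /tot (bigD1 t) //= [in RHS](bigD1 t) //= upd_same.
  rewrite [in RHS](eq_bigr (fun x => par (d x))) => [|x xt]; last by rewrite upd_other.
  by case: (par (d t)); case: (par i); case: (\big[_/_]_(_ | _) _); case: be {hw IH}.
apply: homogM; last exact: IH.
by rewrite /slot_coef; case: (kap t) => //; rewrite addbC.
Qed.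

Lemma grps_diag (B : pzRingType) l (w : {ffun A -> B}) d
    (h := fun i j : I => sg (par i) (i == j)%:R : B) :
  grps par pos kap h h l w d = sg (\big[addb/false]_(t <- l) par (d t)) (w d).
Proof.
elim: l d => [|t l IH] d /=; first by rewrite big_nil.
rewrite /grp slotopE big_cons (bigD1 (d t)) //= big1 ?addr0 => [|i /negPf it].
  rewrite /slot_sign addbb /= IH upd_id /slot_coef /h eqxx.
  by case: (kap t); rewrite sgMl mul1r sg_sg.
rewrite /slot_coef /h [d t == i]eq_sym it.
by case: (kap t); rewrite ?it sg0 mul0r sg0.
Qed.

Section Infinitesimal.
Variables (k : fieldType) (i j : I).
Notation dn := (dual_numbers k).

(** With eps the infinitesimal, these are 1 + eps E_ij and its inverse 1 - eps E_ij, while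
    [lift w v] is w + eps v; the eps-component of the group action is the action of gl(m|n). *)
Definition inf_pos (a b : I) : dn := ((a == b)%:R, ((a == i) && (b == j))%:R).
Definition inf_neg (a b : I) : dn := ((a == b)%:R, - ((a == i) && (b == j))%:R).
Definition lift (w v : {ffun A -> k}) : {ffun A -> dn} := [ffun d => ((w d, v d) : dn)].

Lemma dual_sumE (J : Type) (l : seq J) (F : J -> dn) :
  ((\sum_(x <- l) F x).1 = \sum_(x <- l) (F x).1) *
  ((\sum_(x <- l) F x).2 = \sum_(x <- l) (F x).2).
Proof. by split; elim/big_rec2: _ => // x u v _ <-. Qed.

Lemma dual_sgE s (u : dn) : ((sg s u).1 = sg s u.1) * ((sg s u).2 = sg s u.2).
Proof. by case: s. Qed.

Lemma grp_inf t w v : grp par pos kap inf_pos inf_neg t (lift w v) =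
  lift w (v + gl_unit par pos kap t i j w).
Proof.
have cE (a b : I) : slot_coef inf_pos inf_neg (kap t) a b =
    ((a == b)%:R, unit_coef k (kap t) i j a b) :> dn.
  rewrite /slot_coef /unit_coef; case: (kap t) => //=.
  by rewrite /inf_neg eq_sym andbC.
apply/ffunP => d; rewrite /grp slotopE !ffunE.
apply: dual_eq; rewrite dual_sumE /=.
  transitivity (slotop par pos kap t (fun a b : I => (a == b)%:R) w d); last by rewrite slotop1.
  rewrite slotopE; apply: eq_bigr => a _; rewrite dual_sgE cE ffunE; by [].
transitivity (slotop par pos kap t (fun a b : I => (a == b)%:R) v d + gl_unit par pos kap t i j w d).
  rewrite /gl_unit !slotopE -big_split /=; apply: eq_bigr => a _.
  by rewrite dual_sgE cE ffunE /= -sgD.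
by rewrite slotop1 /gl_unit !ffunE.
Qed.

Lemma grps_inf l w v : grps par pos kap inf_pos inf_neg l (lift w v) =
  lift w (v + \sum_(t <- l) gl_unit par pos kap t i j w).
Proof.
elim: l => [|t l IH] /=; first by rewrite big_nil addr0.
by rewrite IH grp_inf big_cons -addrA [X in v + X]addrC.
Qed.

Lemma kernel_inf a b :
  (kernel (grps par pos kap inf_pos inf_neg (enum T)) a b).2 =
  kernel (gl_sum par pos kap i j) a b :> k.
Proof.
rewrite /kernel (_ : basis _ b = lift (basis k b) 0); last first.
  apply/ffunP => d; rewrite !ffunE; apply: dual_eq; by case: (d == b).
by rewrite grps_inf !ffunE /= add0r big_enum.
Qed.
End Infinitesimal.
End Entries.

(** * The two supercommuting copies inside a super tensor product *)

Section Tensor.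
Variables (k : fieldType) (A B T : superAlgebra k) (tens : A -> B -> T).
Hypothesis tensP : is_super_tensor tens.

Lemma tensDl x x' y : tens (x + x') y = tens x y + tens x' y.
Proof. by case: tensP => -[h _] _ _ _ _; have := h y 1 x x'; rewrite !scale1r. Qed.
Lemma tensDr x y y' : tens x (y + y') = tens x y + tens x y'.
Proof. by case: tensP => -[_ h] _ _ _ _; have := h x 1 y y'; rewrite !scale1r. Qed.

Definition tens1 x := tens x 1.
Definition tens2 y := tens 1 y.

Lemma tens_mul q q' x y w z : homog q y -> homog q' w ->
  tens x y * tens w z = sg (q && q') (tens (x * w) (y * z)).
Proof. by move=> hy hw; case: tensP => _ _ _ _ h; rewrite (h _ _ _ _ _ _ hy hw) sg_signr. Qed.

Lemma tens12 x y : tens x y = tens1 x * tens2 y.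
Proof. by rewrite (tens_mul _ _ (homog1 B) (homog1 A)) mulr1 mul1r. Qed.

Lemma tens1M : {morph tens1 : x y / x * y}.
Proof.
move=> x y; rewrite /tens1 -(part_sum y) mulrDr !tensDl mulrDr.
by rewrite !(tens_mul _ _ (homog1 B) (homog_part _ _)) /= mulr1.
Qed.

Lemma tens2M : {morph tens2 : x y / x * y}.
Proof.
move=> x y; rewrite /tens2 -(part_sum x) mulrDl !tensDr mulrDl.
by rewrite !(tens_mul _ _ (homog_part _ _) (homog1 A)) !andbF /= mulr1.
Qed.

Lemma tens_supercomm q q' x y : homog q x -> homog q' y ->
  tens2 y * tens1 x = sg (q && q') (tens1 x * tens2 y).
Proof.
by move=> hx hy; rewrite -tens12 (tens_mul _ _ hy hx) mul1r mulr1 andbC.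
Qed.

Lemma tens1B : zmod_morphism tens1.
Proof.
move=> x y; apply/eqP; rewrite eq_sym subr_eq; apply/eqP.
by rewrite /tens1 -tensDl subrK.
Qed.
Lemma tens2B : zmod_morphism tens2.
Proof.
move=> x y; apply/eqP; rewrite eq_sym subr_eq; apply/eqP.
by rewrite /tens2 -tensDr subrK.
Qed.
Lemma tens11 : tens1 1 = 1. Proof. by case: tensP. Qed.
Lemma tens21 : tens2 1 = 1. Proof. by case: tensP. Qed.
End Tensor.

(** A product of points acts as the composite as soon as the entries of one supercommute with those
    of the other: the slots of the second factor then move past those of the first. *)
Lemma grps_mulc (I U : finType) (par : I -> bool) (pos : U -> nat) (kap : U -> bool)
    (R : pzRingType) (g1 g1' g2 g2' : I -> I -> R) l w :
  injective pos -> uniq l ->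
  supercomm par g2 g1 -> supercomm par g2 g1' -> supercomm par g2' g1 ->
  supercomm par g2' g1' -> supercomm par g1' g2' ->
  grps par pos kap (mulc g1 g2) (mulc g2' g1') l w =
  grps par pos kap g1 g1' l (grps par pos kap g2 g2' l w).
Proof.
move=> pos_inj + s1 s2 s3 s4 s5; elim: l => //= t l IH /andP[tl ul].
rewrite IH // -grp_comp //; congr (grp _ _ _ _ _ t _).
move: (grps _ _ _ g2 g2' l w) => X.
elim: l tl {IH ul} => //= u l IH; rewrite inE negb_or => /andP[tu tl].
by rewrite (grpC _ pos_inj) // IH.
Qed.

(** * Matrix coefficients and the comultiplication *)

Lemma prod_enum (R : pzRingType) (I : finType) (F : I -> R) :
  \prod_(t <- enum I) F t = \prod_t F t.
Proof. by rewrite enumT [index_enum _]unlock. Qed.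

Section Mulc.
Variables (I : finType) (R R' : pzRingType).
Implicit Types (g h l : I -> I -> R).

Lemma rmorph_mulc (f : {rmorphism R -> R'}) g h i j :
  f (mulc g h i j) = mulc (fun i j => f (g i j)) (fun i j => f (h i j)) i j.
Proof. by rewrite rmorph_sum; apply: eq_bigr => l _; rewrite rmorphM. Qed.

Lemma mulcA g h l i j : mulc g (mulc h l) i j = mulc (mulc g h) l i j.
Proof.
rewrite /mulc; under eq_bigr => c _ do rewrite mulr_sumr.
rewrite exchange_big; apply: eq_bigr => c _; rewrite mulr_suml.
by apply: eq_bigr => e _; rewrite mulrA.
Qed.

Lemma eq_mulc g g' h h' : (forall i j, g i j = g' i j) ->
  (forall i j, h i j = h' i j) -> forall i j, mulc g h i j = mulc g' h' i j.
Proof. by move=> gg hh i j; apply: eq_bigr => l _; rewrite gg hh. Qed.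

Lemma mulc1 g i j : mulc g (fun i j => (i == j)%:R) i j = g i j.
Proof.
rewrite /mulc (bigD1 j) //= eqxx mulr1 big1 ?addr0 // => l /negPf lj.
by rewrite lj mulr0.
Qed.

Lemma mul1c g i j : mulc (fun i j => (i == j)%:R) g i j = g i j.
Proof.
rewrite /mulc (bigD1 i) //= eqxx mul1r big1 ?addr0 // => l /negPf li.
by rewrite eq_sym li mul0r.
Qed.

Lemma mulc_inv g h h' : (forall i j, mulc g h i j = (i == j)%:R) ->
  (forall i j, mulc h' g i j = (i == j)%:R) -> forall i j, h i j = h' i j.
Proof.
move=> gh hg i j; rewrite -(mul1c h) -(eq_mulc hg (fun _ _ => erefl)) -mulcA.
by rewrite (eq_mulc (fun _ _ => erefl) gh) mulc1.
Qed.
End Mulc.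

Section SchurSuperalgebra.
Variables (k : fieldType) (m n r s : nat) (G : coordinateGL k m n).
Notation J := 'I_(m + n).
Notation N := (r + s)%N.
Notation A := {ffun 'I_N -> J}.
Notation par := (@ipar m n).
Notation p i j := (par i (+) par j).
Notation tot := (tot par).
Definition dual_slot (t : 'I_N) := (r <= t)%N.
Notation posM := (@nat_of_ord N).
Notation X := (fun i j : J => glX G i j).
Notation X' := (fun i j : J => glXinv G i j).
Implicit Types (a b c : A).

Lemma glsc : supercommutative G. Proof. exact: coordinate_supercommutative (glXP G). Qed.

Lemma mulc_XX' i j : mulc X X' i j = (i == j)%:R.
Proof.
have := congr1 (fun M : 'M[G]_(m + n) => M i j) (proj1 (glXinvP G)).
by rewrite !mxE => <-.
Qed.

Lemma mulc_X'X i j : mulc X' X i j = (i == j)%:R.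
Proof.
have := congr1 (fun M : 'M[G]_(m + n) => M i j) (proj2 (glXinvP G)).
by rewrite !mxE => <-.
Qed.

Lemma homogX i j : homog (p i j) (X i j).
Proof. exact: coordinate_homog (glXP G) i j. Qed.

Lemma homogX' i j : homog (p i j) (X' i j).
Proof. exact: (homog_inverse homogX mulc_XX' mulc_X'X). Qed.

Definition rmat : A -> A -> G := coef_mx par dual_slot X X'.

Lemma homog_rmat a b : homog (tot a (+) tot b) (rmat a b).
Proof.
apply: (grps_homog _ _ _ homogX homogX') => d; rewrite ffunE.
case: (d =P b) => [->|_]; first by rewrite addbb; apply: homog1.
by rewrite /homog raddf0.
Qed.

(** A dual slot has entry [g' b a] in row [a] and column [b], so for the inverse variables the
    second index is the row. *)
Definition row_idx (u : {ffun 'I_r -> J * J}) (v : {ffun 'I_s -> J * J}) : A :=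
  [ffun t => match split t with inl t => (u t).1 | inr t => (v t).2 end].
Definition col_idx (u : {ffun 'I_r -> J * J}) (v : {ffun 'I_s -> J * J}) : A :=
  [ffun t => match split t with inl t => (u t).2 | inr t => (v t).1 end].

Lemma rmat_monomial u v : exists e, rmat (row_idx u v) (col_idx u v) = sg e (rat_monomial G u v).
Proof.
have [||e E] := @kernel_grps _ _ par posM dual_slot _ X X' (enum 'I_N) (row_idx u v) (col_idx u v).
- exact: enum_uniq.
- by move=> t; rewrite mem_enum.
exists e; rewrite /rmat /coef_mx E; congr (sg _ _).
rewrite prod_enum big_split_ord /rat_monomial /=; congr (_ * _).
  apply: eq_bigr => t _; rewrite /slot_coef /dual_slot /= leqNgt ltn_ord /=.
  by rewrite !ffunE (unsplitK (inl t)).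
apply: eq_bigr => t _; rewrite /slot_coef /dual_slot /= leq_addr.
by rewrite !ffunE (unsplitK (inr t)).
Qed.

Lemma idxK a b : exists u v, row_idx u v = a /\ col_idx u v = b.
Proof.
exists [ffun t => (a (lshift s t), b (lshift s t))], [ffun t => (b (rshift r t), a (rshift r t))].
by split; apply/ffunP => t; rewrite ffunE; case: splitP => t' tt'; rewrite ffunE /=;
  congr (_ _); apply: val_inj.
Qed.

Lemma monomial_pred (u : {ffun 'I_r -> J * J}) (v : {ffun 'I_s -> J * J}) : rat_monomial G u v \in @rat_coeff_pred k m n G r s.
Proof.
apply/asboolP; exists (fun u' v' => ((u' == u) && (v' == v))%:R).
rewrite (bigD1 u) //= (bigD1 v) //= !eqxx scale1r [X in _ + X + _]big1 ?addr0; last first.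
  by move=> v' /negPf vv; rewrite vv scale0r.
rewrite big1 ?addr0 // => u' /negPf uu.
by rewrite big1 // => v' _; rewrite uu scale0r.
Qed.

Definition monoRC u v : ratCoeff G r s := RatCoeff (monomial_pred u v).

Lemma rmat_pred a b : rmat a b \in @rat_coeff_pred k m n G r s.
Proof.
have [u [v [<- <-]]] := idxK a b; have [e ->] := rmat_monomial u v.
by case: e; rewrite /sg ?rpredN monomial_pred.
Qed.

Definition rmatRC a b : ratCoeff G r s := RatCoeff (rmat_pred a b).

Lemma rcvalD (x x' : ratCoeff G r s) : rcval (x + x') = rcval x + rcval x'.
Proof. by []. Qed.
Lemma rcval_sum (K : Type) (l : seq K) (F : K -> ratCoeff G r s) :
  rcval (\sum_(i <- l) F i) = \sum_(i <- l) rcval (F i).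
Proof. exact: (big_morph _ rcvalD). Qed.

Lemma ratCoeff_span (x : ratCoeff G r s) :
  exists f : {ffun 'I_r -> J * J} -> {ffun 'I_s -> J * J} -> k,
    x = \sum_u \sum_v f u v *: monoRC u v.
Proof.
have /asboolP[c E] := valP x; exists c; apply: val_inj; rewrite /= E rcval_sum.
by apply: eq_bigr => u _; rewrite rcval_sum.
Qed.

(** Each monomial is homogeneous, being up to sign an entry of the generic matrix; so functionals on
    [ratCoeff] can be split by parity. *)
Lemma part_pred q x : x \in @rat_coeff_pred k m n G r s -> part q x \in @rat_coeff_pred k m n G r s.
Proof.
have partZ (c : k) (y : G) : part q (c *: y) = c *: part q y by rewrite linearZ.
move=> /asboolP[c ->]; rewrite raddf_sum; apply: rpred_sum => u _.
rewrite raddf_sum; apply: rpred_sum => v _; rewrite /= partZ; apply: rpredZ.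
have [e E] := rmat_monomial u v.
have hm : homog (tot (row_idx u v) (+) tot (col_idx u v)) (rat_monomial G u v).
  have := homog_rmat (row_idx u v) (col_idx u v); rewrite E => /(homog_sg e).
  by rewrite sg_sg addbb.
rewrite /= (part_homog _ hm); case: eqP => _; last exact: rpred0.
exact: monomial_pred.
Qed.

Definition partRC q (x : ratCoeff G r s) : ratCoeff G r s := RatCoeff (part_pred q (valP x)).

Section Delta.
Notation tens := (@gltens k m n G).
Notation D := (glDelta G).

Let t1 : {rmorphism G -> glT G} := HB.pack (tens1 tens)
  (GRing.isZmodMorphism.Build _ _ (tens1 tens) (tens1B (gltensP G)))
  (GRing.isMonoidMorphism.Build _ _ (tens1 tens) (tens11 (gltensP G), tens1M (gltensP G))).
Let t2 : {rmorphism G -> glT G} := HB.pack (tens2 tens)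
  (GRing.isZmodMorphism.Build _ _ (tens2 tens) (tens2B (gltensP G)))
  (GRing.isMonoidMorphism.Build _ _ (tens2 tens) (tens21 (gltensP G), tens2M (gltensP G))).

(** The comultiplication sends the generic matrix to the product of its two copies in the tensor
    square, which supercommute; the action of a product is the composite, and its entries are read
    off. *)
Lemma Delta_rmat a b : D (rmat a b) = \sum_c gltens (rmat a c) (rmat c b).
Proof.
pose g1 i j := t1 (X i j); pose g1' i j := t1 (X' i j).
pose g2 i j := t2 (X i j); pose g2' i j := t2 (X' i j).
have DX i j : D (X i j) = mulc g1 g2 i j.
  by rewrite /mulc glDeltaX; apply: eq_bigr => l _; rewrite (tens12 (gltensP G)).
(* The value on the inverse variables is forced: the product of the inverse copies in reversed order
   is a left inverse of the image of [X]. *)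
have DX' i j : D (X' i j) = mulc g2' g1' i j.
  apply: (@mulc_inv _ _ (fun i j => D (X i j)) (fun i j => D (X' i j)) _ _ _ i j).
    by move=> i1 j1; rewrite -(rmorph_mulc D X X') mulc_XX' rmorph_nat.
  move=> i1 j1; rewrite (eq_mulc (fun _ _ => erefl) DX) mulcA.
  transitivity (mulc g2' g2 i1 j1); last by rewrite -(rmorph_mulc t2 X' X) mulc_X'X rmorph_nat.
  apply: eq_mulc => // i2 j2; rewrite -mulcA -[RHS]mulc1; apply: eq_mulc => // i3 j3.
  by rewrite -(rmorph_mulc t1 X' X) mulc_X'X rmorph_nat.
have sc1 (g h : J -> J -> G) : (forall i j, homog (p i j) (g i j)) ->
    (forall i j, homog (p i j) (h i j)) ->
    supercomm par (fun i j => t1 (g i j)) (fun i j => t2 (h i j)).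
  move=> hg hh i j i' j'; rewrite /= (tens_supercomm (gltensP G) (hg i j) (hh i' j')).
  by rewrite sg_sg addbb.
have sc2 (g h : J -> J -> G) : (forall i j, homog (p i j) (g i j)) ->
    (forall i j, homog (p i j) (h i j)) ->
    supercomm par (fun i j => t2 (g i j)) (fun i j => t1 (h i j)).
  move=> hg hh i j i' j'; rewrite /= (tens_supercomm (gltensP G) (hh i' j') (hg i j)).
  by rewrite andbC.
have hX := homogX; have hX' := homogX'.
transitivity (mapf D (grps par posM dual_slot X X' (enum 'I_N) (basis G b)) a).
  by rewrite ffunE.
rewrite (mapf_grps _ _ _ _ _ DX DX') mapf_basis.
rewrite grps_mulc ?enum_uniq //; try by [apply: sc1 | apply: sc2]; last exact: val_inj.
rewrite (kernelE (F := grps par posM dual_slot g1 g1' (enum 'I_N))); last exact: grps_scaler.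
apply: eq_bigr => c _; rewrite (tens12 (gltensP G)).
rewrite -[tens1 _ _]/(t1 _) -[tens2 _ _]/(t2 _) /rmat /coef_mx /kernel.
congr (_ * _).
  transitivity (mapf t1 (grps par posM dual_slot X X' (enum 'I_N) (basis G c)) a).
    by rewrite (@mapf_grps _ _ _ _ _ _ _ t1 _ _ g1 g1') // mapf_basis.
  by rewrite ffunE.
transitivity (mapf t2 (grps par posM dual_slot X X' (enum 'I_N) (basis G b)) c).
  by rewrite (@mapf_grps _ _ _ _ _ _ _ t2 _ _ g2 g2') // mapf_basis.
by rewrite ffunE.
Qed.
End Delta.

End SchurSuperalgebra.

(** * The representation of the Schur superalgebra *)

Section SchurRepresentation.
Variables (k : fieldType) (m n r s : nat) (G : coordinateGL k m n).
Hypothesis chark : [pchar k] =i pred0.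
Hypothesis hmn : m%:Z - n%:Z >= (r + s)%N%:Z.
Variables (S : algType k) (ev : S -> {scalar ratCoeff G r s}).
Hypothesis hS : is_rational_Schur ev.
Notation J := 'I_(m + n).
Notation N := (r + s)%N.
Notation A := {ffun 'I_N -> J}.
Notation par := (@ipar m n).
Notation p i j := (par i (+) par j).
Notation tot := (tot par).
Notation kapM := (@dual_slot r s).
Notation posM := (@nat_of_ord N).
Notation X := (fun i j : J => glX G i j).
Notation X' := (fun i j : J => glXinv G i j).
Notation rmatRC := (@rmatRC k m n r s G).
Notation rmat := (@rmat k m n r s G).
Implicit Types (a b c : A).

Lemma natr_neq0 d : (d.+1%:R : k) != 0.
Proof. by move/pcharf0P: chark => ->. Qed.

Lemma torsion_free_G : torsion_free G.
Proof.
move=> d x; rewrite -scaler_nat => H; have := congr1 (fun y : G => d.+1%:R^-1 *: y) H.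
by rewrite scalerA mulVf ?natr_neq0 // scale1r scaler0.
Qed.

Lemma sdim_GL : \sum_(i : J) sg (par i) (1 : int) = (m - n)%N%:Z.
Proof.
rewrite big_split_ord /=.
under eq_bigr => i _ do rewrite /ipar /= leqNgt ltn_ord /=.
under [X in _ + X]eq_bigr => i _ do rewrite /ipar /= leq_addr /=.
by rewrite !sumr_const !card_ord mulNrn -subzn; [rewrite !natz | lia].
Qed.

Lemma Ndelta : (N <= m - n)%N. Proof. lia. Qed.

(* The sign cancels the one in the product of S, making this multiplicative. *)
Definition schur_rep (f : S) a b : k := sg (tot a && (tot a (+) tot b)) (ev f (rmatRC a b)).

Lemma evL (c : k) f g x : ev (c *: f + g) x = c * ev f x + ev g x.
Proof. by case: hS. Qed.

Lemma evD f g x : ev (f + g) x = ev f x + ev g x.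
Proof. by rewrite -[f]scale1r evL mul1r scale1r. Qed.

Lemma schur_rep_linear (c : k) f g a b : schur_rep (c *: f + g) a b = c * schur_rep f a b + schur_rep g a b.
Proof. by rewrite /schur_rep evL sgD sgMr. Qed.

Lemma schur_rep_inj f g : (forall a b, schur_rep f a b = schur_rep g a b) -> f = g.
Proof.
move=> fg; case: hS => _ inj _ _ _; apply: inj => x.
have [c ->] := ratCoeff_span x; rewrite !linear_sum; apply: eq_bigr => u _.
rewrite !linear_sum; apply: eq_bigr => v _; rewrite !linearZ; congr (_ * _).
have [e E] := rmat_monomial G u v.
have -> : monoRC G u v = sg e (rmatRC (row_idx u v) (col_idx u v)).
  apply: val_inj; rewrite raddf_sg /=; rewrite E sg_sg addbb.
  by [].
rewrite !raddf_sg; congr (sg _ _); have := fg (row_idx u v) (col_idx u v).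
by rewrite /schur_rep => /(congr1 (sg (tot (row_idx u v) && (tot (row_idx u v) (+) tot (col_idx u v))))); rewrite !sg_sg addbb.
Qed.

Lemma functional_exists (l : {linear G -> k^o}) : exists f, forall x, ev f x = l (rcval x).
Proof.
have pL : linear_for *%R (fun x : ratCoeff G r s => l (rcval x) : k).
  by move=> c x y; rewrite linearP.
pose phi : {scalar ratCoeff G r s} := HB.pack (fun x : ratCoeff G r s => l (rcval x) : k)
  (GRing.isLinear.Build k _ _ _ _ pL).
by case: hS => _ _ /(_ phi)[f Ef] _ _; exists f => x; rewrite Ef.
Qed.

(** The product formula of [is_rational_Schur] is available only for a homogeneous right factor. *)
Lemma homog_split (g : S) : exists g0 g1, [/\ g = g0 + g1,
  homog_dual false (ev g0) & homog_dual true (ev g1)].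
Proof.
have hpart q : exists f, forall x, ev f x = ev g (partRC q x).
  have pL : linear_for *%R (fun x : ratCoeff G r s => ev g (partRC q x)).
    move=> c x y; rewrite -linearP; congr (ev g _); apply: val_inj => /=.
    exact: part_linear.
  pose phi : {scalar ratCoeff G r s} := HB.pack (fun x : ratCoeff G r s => ev g (partRC q x))
    (GRing.isLinear.Build k _ _ _ _ pL).
  by case: hS => _ _ /(_ phi)[f Ef] _ _; exists f => x; rewrite Ef.
have [g0 E0] := hpart false; have [g1 E1] := hpart true; exists g0, g1; split.
- case: hS => _ inj _ _ _; apply: inj => x; rewrite evD E0 E1 -linearD.
  by congr (ev g _); apply: val_inj; symmetry; exact: part_sum.
- move=> x hx; rewrite E0 (_ : partRC _ _ = 0) ?linear0 //; apply: val_inj => /=.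
  by rewrite (part_homog _ hx).
- move=> x hx; rewrite E1 (_ : partRC _ _ = 0) ?linear0 //; apply: val_inj => /=.
  by rewrite (part_homog _ hx).
Qed.

Lemma schur_repM_homog q f g a b : homog_dual q (ev g) -> schur_rep (f * g) a b = mulk (schur_rep f) (schur_rep g) a b.
Proof.
move=> hg; case: hS => _ _ _ _ mulP.
have := mulP f g q hg (rmatRC a b) #|A| (fun t => rmatRC a (enum_val t)) (fun t => rmatRC (enum_val t) b)
  (fun t => tot a (+) tot (enum_val t)).
move=> /(_ (fun t => homog_rmat G a (enum_val t))) E.
rewrite {1}/schur_rep E; last first.
  rewrite /= Delta_rmat (reindex (enum_val (A := {: A}))) //=; exact/onW_bij/enum_val_bij.
rewrite /mulk (reindex (enum_val (A := {: A}))) /=; last exact/onW_bij/enum_val_bij.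
rewrite sg_sum; apply: eq_bigr => t _; rewrite sg_signr /schur_rep sgMl sgMr !sg_sg.
set c := enum_val t.
(* Only indices [c] for which the right entry has the parity of [g] contribute, and for them the
   three signs combine to that of [schur_rep]. *)
case: (eqVneq (tot c (+) tot b) q) => [<-|cb].
  by congr (sg _ _); case: (tot a); case: (tot b); case: (tot c).
rewrite (_ : ev g (rmatRC c b) = 0) ?mulr0 ?sg0 //; apply: hg.
have -> : ~~ q = tot c (+) tot b by move: cb; case: q {E}; case: (_ (+) _).
exact: homog_rmat.
Qed.

Lemma schur_repM f g a b : schur_rep (f * g) a b = mulk (schur_rep f) (schur_rep g) a b.
Proof.
have RD h h' a' b' : schur_rep (h + h') a' b' = schur_rep h a' b' + schur_rep h' a' b'.
  by rewrite /schur_rep evD sgD.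
have [g0 [g1 [-> h0 h1]]] := homog_split g.
rewrite mulrDr RD (schur_repM_homog _ _ _ h0) (schur_repM_homog _ _ _ h1) -big_split.
by apply: eq_bigr => c _; rewrite /= -mulrDr RD.
Qed.

(** [z] commutes with the generic matrix, hence, on applying [ev f] to the entries, with every
    element of S; as [z] is even, the signs of [schur_rep] agree on both sides. *)
Lemma schur_rep_comm j (z : A -> A -> k) : hasp par false z ->
  iter j (@casimir J _ par (@posW N) (kapW kapM) k) (vec par kapM z) = 0 ->
  forall f a b, mulk (schur_rep f) z a b = mulk z (schur_rep f) a b.
Proof.
move=> hz Cz f a b.
have hX := homogX G; have hX' := homogX' G; have sc := @glsc k m n G.
have central (x : k) (y : G) : GRing.in_alg G x * y = y * GRing.in_alg G x.
  by rewrite /= -scalerAl -scalerAr mul1r mulr1.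
have := @nilp_commutes _ par _ kapM k G (GRing.in_alg G) central torsion_free_G X X'
  (supercomm_homog sc hX hX) (supercomm_homog sc hX hX') (supercomm_homog sc hX' hX)
  (supercomm_homog sc hX' hX') (mulc_XX' G) (mulc_X'X G) _ sdim_GL Ndelta z j hz Cz a b.
rewrite /mulk -/(rmat) => E.
have E' : \sum_c z c b *: rmatRC a c = \sum_c z a c *: rmatRC c b.
  apply: val_inj; rewrite /= !rcval_sum.
  transitivity (\sum_c rmat a c * GRing.in_alg G (z c b)).
    by apply: eq_bigr => c _; rewrite /= -scalerAr mulr1.
  by rewrite E; apply: eq_bigr => c _; rewrite /= -scalerAl mul1r.
have := congr1 (fun x => sg (tot a && (tot a (+) tot b)) (ev f x)) E'.
rewrite !linear_sum /= !sg_sum => E2.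
transitivity (\sum_c sg (tot a && (tot a (+) tot b)) (ev f (z c b *: rmatRC a c))).
  apply: eq_bigr => c _; rewrite linearZ /= /schur_rep.
  case: (eqVneq (tot c (+) tot b) false) => [cb|/hz ->]; last by rewrite mulr0 mul0r sg0.
  by rewrite sgMl mulrC; congr (sg _ _); move: cb; case: (tot c); case: (tot b).
rewrite E2; apply: eq_bigr => c _; rewrite linearZ /= /schur_rep.
case: (eqVneq (tot a (+) tot c) false) => [ac|/hz ->]; last by rewrite !mul0r sg0.
by rewrite sgMr; congr (sg _ _); move: ac; case: (tot a); case: (tot c).
Qed.

Lemma snd_linear tau (phi : {lrmorphism G -> dual_super k tau}) :
  linear (fun x : G => (phi x).2 : k^o).
Proof. by move=> c x y /=; rewrite linearP. Qed.
Lemma fst_linear tau (phi : {lrmorphism G -> dual_super k tau}) :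
  linear (fun x : G => (phi x).1 : k^o).
Proof. by move=> c x y /=; rewrite linearP. Qed.

Lemma point_rmat tau (phi : {lrmorphism G -> dual_super k tau}) (h h' : J -> J -> dual_super k tau) :
  (forall i j, phi (X i j) = h i j) -> (forall i j, mulc h' h i j = (i == j)%:R) ->
  forall a b, phi (rmat a b) =
    kernel (grps par posM kapM h h' (enum 'I_N)) a b.
Proof.
move=> ph hh a b.
have ph' i j : phi (X' i j) = h' i j.
  apply: (@mulc_inv _ _ h (fun i j => phi (X' i j)) h' _ hh i j) => i1 j1.
  rewrite -(eq_mulc ph (fun _ _ => erefl)).
  by rewrite -(rmorph_mulc phi X X') mulc_XX' rmorph_nat.
transitivity (mapf phi (grps par posM kapM X X' (enum 'I_N) (basis G b)) a).
  by rewrite ffunE.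
by rewrite (mapf_grps _ _ _ _ _ ph ph') mapf_basis.
Qed.

Lemma schur_rep_parity : exists pi, forall a b, schur_rep pi a b = sg (tot a) (a == b)%:R.
Proof.
(* The point diag(1, -1), viewed over the dual numbers with zero infinitesimal part so that
   [point_exists] provides it; the functional is the first component. *)
pose h := fun i j : J => sg (par i) (i == j)%:R : dual_super k false.
have hh i j : mulc h h i j = (i == j)%:R.
  rewrite /mulc (bigD1 i) //= big1 ?addr0 => [|l /negPf li].
    by rewrite /h eqxx sgMl mul1r sg_sg addbb.
  by rewrite /h [i == l]eq_sym li sg0 mul0r.
have [|||phi ph] := @point_exists k m n G (glX G) (glXP G) false h (fun i => sg (par i) 1).
- move=> i j; rewrite /h; case: (i =P j) => [->|_]; last by rewrite sg0 /homog raddf0.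
  by rewrite addbb; apply: homog_sg; apply: homog1.
- by move=> i; rewrite /sg; case: (par i); rewrite ?oppr_eq0 oner_eq0.
- by move=> i j; rewrite /h dual_sgE sgMl mul1r; case: (i == j).
have [f Ef] := functional_exists (HB.pack (fun x : G => (phi x).1 : k^o) (GRing.isLinear.Build k _ _ _ _ (fst_linear phi))).
exists f => a b; rewrite /schur_rep Ef /= (point_rmat ph hh) /kernel grps_diag big_enum ffunE /=.
rewrite dual_sgE -/(tot a); case: (a =P b) => [->|_] /=; last by rewrite !sg0.
by rewrite addbb andbF.
Qed.

Lemma schur_rep_unit i j : exists f, forall a b, schur_rep f a b = gl_kernel par kapM k i j a b.
Proof.
pose h := inf_pos k i j : J -> J -> dual_super k (p i j).
pose h' := inf_neg k i j : J -> J -> dual_super k (p i j).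
have hh (a b : J) : mulc h' h a b = (a == b)%:R.
  apply: dual_eq; rewrite /mulc dual_sumE /=.
    rewrite (bigD1 a) //= eqxx mul1r big1 ?addr0 => [|l /negPf la]; first by case: (a == b).
    by rewrite [a == l]eq_sym la mul0r.
  rewrite big_split /= (bigD1 a) //= eqxx mul1r [X in _ + X + _]big1 ?addr0; last first.
    by move=> l /negPf la; rewrite [a == l]eq_sym la mul0r.
  rewrite (bigD1 b) //= eqxx mulr1 big1 ?addr0; last by move=> l /negPf lb; rewrite lb mulr0.
  by rewrite subrr; case: (a == b).
have [|||phi ph] := @point_exists k m n G (glX G) (glXP G) (p i j) h (fun=> 1).
- move=> a b; rewrite /homog; apply: dual_eq => /=.
    by case: (a =P b) => [->|_]; rewrite ?addbb //; case: (p a b).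
  by case: (a =P i) => [->|_]; case: (b =P j) => [->|_]; rewrite ?eqxx //=; case: (_ == _).
- by move=> i1; apply: oner_neq0.
- by move=> a b; rewrite mul1r.
have [f Ef] := functional_exists (HB.pack (fun x : G => (phi x).2 : k^o) (GRing.isLinear.Build k _ _ _ _ (snd_linear phi))).
have Rf a b : schur_rep f a b = sg (tot a && p i j) (gl_kernel par kapM k i j a b).
  rewrite /schur_rep Ef /= (point_rmat ph hh) kernel_inf -/(gl_kernel _ _ _ _ _ _ _).
  case: (eqVneq (tot a (+) tot b) (p i j)) => [->//|/hasp_gl_kernel ->].
  by rewrite !sg0.
have [pi Epi] := schur_rep_parity.
(* For an odd elementary matrix the sign in [schur_rep] depends on the row parity; multiplying by
   the parity operator from the left removes it. *)
exists (if p i j then pi * f else f) => a b; case: (boolP (p i j)) => pij; last first.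
  by rewrite Rf (negPf pij) andbF.
rewrite schur_repM /mulk (bigD1 a) //= big1 ?addr0 => [|c /negPf ca]; last first.
  by rewrite Epi eq_sym ca sg0 mul0r.
by rewrite Epi eqxx sgMl mul1r Rf pij andbT sg_sg addbb.
Qed.

Theorem rational_Schur_semisimple : semisimple S.
Proof.
have [pi Epi] := schur_rep_parity.
have /choice[Y1 EY1] : forall ij : J * J, exists f, forall a b, schur_rep f a b = gl_kernel par kapM k ij.1 ij.2 a b.
  by move=> ij; apply: schur_rep_unit.
apply: (@semisimple_of_rep k J par N kapM (natr_neq0 1) S schur_rep schur_rep_linear schur_repM schur_rep_inj
  (fun i j => Y1 (i, j)) _ pi Epi schur_rep_comm).
by move=> i j a b; rewrite EY1.
Qed.

End SchurRepresentation.

Theorem mainTheorem4 (k : closedFieldType) (chark : [pchar k] =i pred0)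
    (m n r s : nat) (hmn : m%:Z - n%:Z >= (r + s)%N%:Z)
    (G : coordinateGL k m n)
    (S : algType k) (ev : S -> {scalar ratCoeff G r s})
    (hS : is_rational_Schur ev) :
  semisimple S.
Proof. exact: (rational_Schur_semisimple chark hmn hS). Qed.
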